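(* Let $\mathbb{G}$ be a discrete quantum group and $0\neq P\in\ell^\infty(\mathbb{G})$ a group-like projection, and let $M_P=\{x\in\ell^\infty(\mathbb{G}):(1\otimes P)\Delta_{\mathbb{G}}(x)(1\otimes P)=x\otimes P\}$. Then $M_P$ is amenable if and only if there exists a state $m:\ell^\infty(\mathbb{G})\to\mathbb{C}$ such that $m(P)\neq0$ and $(PfP)*m=f(P)m$ for all $f\in\ell^1(\mathbb{G})$.
   Context: $\mathbb{G}$ has von Neumann algebra $\ell^\infty(\mathbb{G})$, coproduct $\Delta_{\mathbb{G}}$ and predual $\ell^1(\mathbb{G})$, a unital Banach algebra under convolution. For $x\in\ell^\infty(\mathbb{G})$, $f\in\ell^1(\mathbb{G})$, $m\in\ell^\infty(\mathbb{G})^*$: the right module action is $x*f=(f\otimes\mathrm{id})\Delta_{\mathbb{G}}(x)$, and $f*m\in\ell^\infty(\mathbb{G})^*$ is $(f*m)(x)=m(x*f)$. $PfP\in\ell^1(\mathbb{G})$ is $(PfP)(x)=f(PxP)$. A group-like projection is a self-adjoint projection $P\in\ell^\infty(\mathbb{G})$ with $(1\otimes P)\Delta_{\mathbb{G}}(P)=P\otimes P$. $M_P$ is a weak$^*$ closed right invariant subspace, i.e. $x*f\in M_P$ for $x\in M_P$, $f\in\ell^1(\mathbb{G})$. A weak$^*$ closed right invariant subspace $X\subseteq\ell^\infty(\mathbb{G})$ is amenable if there is a unital completely positive right $\ell^1(\mathbb{G})$-module projection of $\ell^\infty(\mathbb{G})$ onto $X$. *)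

(* Defs.v *)
From HB Require Import structures.
From mathcomp Require Import all_boot all_order all_algebra finmap ring.
From mathcomp Require Import sesquilinear spectral complex mxtens.
From mathcomp Require Import boolp classical_sets functions cardinality filter.
From mathcomp Require Import reals topology normedtype summability.

Set Implicit Arguments.
Unset Strict Implicit.
Unset Printing Implicit Defensive.

Import Order.TTheory GRing.Theory Num.Theory.
Import numFieldNormedType.Exports.

Local Open Scope classical_set_scope.
Local Open Scope ring_scope.
Local Open Scope sesquilinear_scope.

Section OperatorNorm.
Variable R : realType.
Local Notation C := R[i].

Definition sqnorm n (v : 'cV[C]_n) : C := \sum_k `|v k 0| ^+ 2.

(* The operator norm of A, for the Euclidean norms, is at most K. *)
Definition opnorm_le m n (K : C) (A : 'M[C]_(m, n)) : Prop :=
  0 <= K /\ forall v : 'cV[C]_n, sqnorm (A *m v) <= K ^+ 2 * sqnorm v.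

Lemma sqnorm_ge0 n (v : 'cV[C]_n) : 0 <= sqnorm v.
Proof. by apply: sumr_ge0 => k _; rewrite exprn_ge0. Qed.

Lemma sqnormE n (v : 'cV[C]_n) : sqnorm v = (v^t* *m v) 0 0.
Proof. by rewrite mxE; apply: eq_bigr => k _; rewrite !mxE normCK mulrC. Qed.

Lemma sqnorm0 n : sqnorm (0 : 'cV[C]_n) = 0.
Proof. by rewrite /sqnorm big1// => k _; rewrite mxE normr0 expr0n. Qed.

Lemma sqnormZ n a (v : 'cV[C]_n) : sqnorm (a *: v) = `|a| ^+ 2 * sqnorm v.
Proof.
by rewrite /sqnorm mulr_sumr; apply: eq_bigr => k _; rewrite mxE normrM exprMn.
Qed.

Lemma sqnormD n (u v : 'cV[C]_n) :
  sqnorm (u + v) <= 2 * (sqnorm u + sqnorm v).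
Proof.
rewrite /sqnorm -big_split mulr_sumr; apply: ler_sum => k _; rewrite mxE /=.
have -> : 2 * (`|u k 0| ^+ 2 + `|v k 0| ^+ 2) =
    `|u k 0 + v k 0| ^+ 2 + `|u k 0 - v k 0| ^+ 2.
  by rewrite !normCK !(rmorphD, rmorphN)/=; ring.
by rewrite lerDl exprn_ge0.
Qed.

Lemma opnorm_le0 m n : opnorm_le 0 (0 : 'M[C]_(m, n)).
Proof.
by split=> // v; rewrite mul0mx sqnorm0 expr0n mul0r.
Qed.

Lemma opnorm_le1 n : opnorm_le 1 (1%:M : 'M[C]_n).
Proof. by split=> // v; rewrite mul1mx expr1n mul1r. Qed.

Lemma opnorm_le_trans m n K L (A : 'M[C]_(m, n)) :
  K <= L -> opnorm_le K A -> opnorm_le L A.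
Proof.
move=> KL [K0 AK]; have L0 := le_trans K0 KL; split=> // v.
apply: le_trans (AK v) _; apply: ler_wpM2r; first exact: sqnorm_ge0.
by rewrite lerXn2r.
Qed.

Lemma opnorm_leZ m n K a (A : 'M[C]_(m, n)) :
  opnorm_le K A -> opnorm_le (`|a| * K) (a *: A).
Proof.
move=> [K0 AK]; split=> [|v]; first by rewrite mulr_ge0.
rewrite -scalemxAl sqnormZ exprMn -[leRHS]mulrA; apply: ler_wpM2l.
  by rewrite exprn_ge0.
exact: AK.
Qed.

Lemma opnorm_leN m n K (A : 'M[C]_(m, n)) : opnorm_le K A -> opnorm_le K (- A).
Proof. by move/(opnorm_leZ (-1)); rewrite scaleN1r normrN1 mul1r. Qed.

Lemma opnorm_leD m n K L (A B : 'M[C]_(m, n)) :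
  opnorm_le K A -> opnorm_le L B -> opnorm_le (2 * (K + L)) (A + B).
Proof.
move=> [K0 AK] [L0 BL]; split=> [|v]; first by rewrite mulr_ge0// addr_ge0.
rewrite mulmxDl; apply: le_trans (sqnormD _ _) _.
have s0 := sqnorm_ge0 v.
apply: (@le_trans _ _ (2 * (K ^+ 2 * sqnorm v + L ^+ 2 * sqnorm v))).
  by apply: ler_wpM2l => //; apply: lerD; [exact: AK | exact: BL].
rewrite -subr_ge0.
have -> : (2 * (K + L)) ^+ 2 * sqnorm v -
    2 * (K ^+ 2 * sqnorm v + L ^+ 2 * sqnorm v) =
    (2 * K ^+ 2 + 2 * L ^+ 2 + 8 * (K * L)) * sqnorm v by ring.
by rewrite mulr_ge0// !addr_ge0// mulr_ge0// ?exprn_ge0// mulr_ge0.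
Qed.

Lemma opnorm_leM m n p K L (A : 'M[C]_(m, n)) (B : 'M[C]_(n, p)) :
  opnorm_le K A -> opnorm_le L B -> opnorm_le (K * L) (A *m B).
Proof.
move=> [K0 AK] [L0 BL]; split=> [|v]; first by rewrite mulr_ge0.
rewrite -mulmxA exprMn -mulrA; apply: le_trans (AK _) _.
by apply: ler_wpM2l; [rewrite exprn_ge0 | exact: BL].
Qed.

Lemma adjmxM m n p (A : 'M[C]_(m, n)) (B : 'M[C]_(n, p)) :
  (A *m B)^t* = B^t* *m A^t*.
Proof. by rewrite trmx_mul map_mxM. Qed.

Lemma adjmxK m n (A : 'M[C]_(m, n)) : A^t*^t* = A.
Proof. by apply/matrixP => i j; rewrite !mxE conjCK. Qed.

Lemma sqnormB n (x y : 'cV[C]_n) : let d := (x^t* *m y) 0 0 in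
  sqnorm (x - y) = sqnorm x + sqnorm y - (d + d^*).
Proof.
rewrite /= mxE /sqnorm rmorph_sum/= -!big_split/= -sumrB; apply: eq_bigr => k _.
by rewrite !mxE !normCK rmorphB rmorphM/= conjCK; ring.
Qed.

Lemma opnorm_le_adj m n K (A : 'M[C]_(m, n)) :
  opnorm_le K A -> opnorm_le K (A^t*).
Proof.
move=> [K0 AK]; split=> // v; have [K00|Kn0] := eqVneq K 0.
  have A0 (w : 'cV[C]_n) : A *m w = 0.
    have := AK w; rewrite K00 expr0n mul0r => s0.
    have {s0} : sqnorm (A *m w) == 0 by rewrite eq_le s0 sqnorm_ge0.
    rewrite psumr_eq0; last by move=> k _; rewrite exprn_ge0.
    move=> /allP h; apply/colP => k; rewrite [RHS]mxE; apply/eqP.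
    by have := h k (mem_index_enum _); rewrite [_ ==> _]expf_eq0 normr_eq0.
  have -> : A = 0.
    apply/matrixP => i j; have /colP/(_ i) := A0 (delta_mx j 0).
    by rewrite -colE !mxE.
  by rewrite trmx0 map_mx0 mul0mx sqnorm0 mulr_ge0 ?exprn_ge0 ?sqnorm_ge0.
have Kp : 0 < K ^+ 2 by rewrite exprn_gt0// lt_neqAle eq_sym Kn0.
set w := A^t* *m v; set x := K ^+ 2 *: v; set y := A *m w.
have xy : (x^t* *m y) 0 0 = K ^+ 2 * sqnorm w.
  have -> : x^t* = K ^+ 2 *: v^t*.
    by apply/matrixP => i j; rewrite !mxE rmorphM; congr (_ * _);
      exact: conj_Creal (ger0_real (exprn_ge0 2 K0)).
  rewrite sqnormE adjmxM adjmxK -scalemxAl mxE /y; congr (_ * _).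
  by rewrite !mulmxA.
have wr : (K ^+ 2 * sqnorm w)^* = K ^+ 2 * sqnorm w.
  by rewrite conj_Creal// ger0_real// mulr_ge0 ?exprn_ge0// sqnorm_ge0.
have h : 0 <= K ^+ 2 * (K ^+ 2 * sqnorm v - sqnorm w).
  apply: (le_trans (sqnorm_ge0 (x - y))).
  rewrite sqnormB xy wr sqnormZ ger0_norm ?exprn_ge0//.
  have := AK w; rewrite -/y -subr_ge0 => h; rewrite -subr_ge0.
  by congr (0 <= _): h; ring.
by move: h; rewrite pmulr_rge0// subr_ge0.
Qed.

End OperatorNorm.

Section TensorMatrices.
Variable R : realType.
Local Notation C := R[i].

(* (id (x) w_rs)(A) and (w_pq (x) id)(A), for w_ab the (a, b) matrix entry *)
Definition mxslicel m n (A : 'M[C]_(m * n)) (r s : 'I_n) : 'M[C]_m :=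
  \matrix_(p, q) A (mxtens_index (p, r)) (mxtens_index (q, s)).

Definition mxslicer m n (A : 'M[C]_(m * n)) (p q : 'I_m) : 'M[C]_n :=
  \matrix_(r, s) A (mxtens_index (p, r)) (mxtens_index (q, s)).

Lemma big_mxtens m n (F : 'I_(m * n) -> C) :
  \sum_k F k = \sum_p \sum_r F (mxtens_index (p, r)).
Proof.
rewrite pair_bigA (reindex (@mxtens_index m n))/=.
  by apply: eq_bigr => -[].
exists (@mxtens_unindex m n) => k _; first exact: mxtens_indexK.
exact: mxtens_unindexK.
Qed.

Lemma opnorm_le_tens m n K L (A : 'M[C]_m) (B : 'M[C]_n) :
  opnorm_le K A -> opnorm_le L B -> opnorm_le (K * L) (A *t B).
Proof.
move=> [K0 AK] [L0 BL]; split=> [|v]; first by rewrite mulr_ge0.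
pose y (q : 'I_m) : 'cV[C]_n := \col_s v (mxtens_index (q, s)) 0.
pose x (r : 'I_n) : 'cV[C]_m := \col_q (B *m y q) r 0.
have -> : sqnorm (A *t B *m v) = \sum_r sqnorm (A *m x r).
  rewrite /sqnorm big_mxtens exchange_big; apply: eq_bigr => r _.
  apply: eq_bigr => p _; congr (`|_| ^+ 2).
  rewrite !mxE big_mxtens; apply: eq_bigr => q _.
  rewrite !mxE mulr_sumr; apply: eq_bigr => s _.
  by rewrite tensmxE !mxE mulrA.
apply: (@le_trans _ _ (\sum_r K ^+ 2 * sqnorm (x r))).
  by apply: ler_sum => r _; exact: AK.
have -> : \sum_r K ^+ 2 * sqnorm (x r) = K ^+ 2 * \sum_q sqnorm (B *m y q).
  rewrite -mulr_sumr /sqnorm exchange_big; congr (_ * _).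
  by apply: eq_bigr => q _; apply: eq_bigr => r _; rewrite mxE.
rewrite exprMn -[leRHS]mulrA; apply: ler_wpM2l; first by rewrite exprn_ge0.
have -> : sqnorm v = \sum_q sqnorm (y q).
  rewrite /sqnorm big_mxtens; apply: eq_bigr => q _.
  by apply: eq_bigr => s _; rewrite mxE.
by rewrite mulr_sumr; apply: ler_sum => q _; exact: BL.
Qed.

Definition tens_col m n (w : 'cV[C]_m) (v : 'cV[C]_n) : 'cV[C]_(m * n) :=
  \col_k (w (mxtens_unindex k).1 0 * v (mxtens_unindex k).2 0).

Lemma sqnorm_tens_col m n (w : 'cV[C]_m) (v : 'cV[C]_n) :
  sqnorm (tens_col w v) = sqnorm w * sqnorm v.
Proof.
rewrite /sqnorm big_mxtens mulr_suml; apply: eq_bigr => p _.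
rewrite mulr_sumr; apply: eq_bigr => r _.
by rewrite mxE mxtens_indexK/= normrM exprMn.
Qed.

Lemma sqnorm_delta n (s : 'I_n) : sqnorm (delta_mx s 0 : 'cV[C]_n) = 1.
Proof.
rewrite /sqnorm (bigD1 s)//= big1 ?addr0 ?mxE ?eqxx ?normr1 ?expr1n// => k ks.
by rewrite mxE (negbTE ks) normr0 expr0n.
Qed.

Lemma opnorm_le_slicel m n K (A : 'M[C]_(m * n)) r s :
  opnorm_le K A -> opnorm_le K (mxslicel A r s).
Proof.
move=> [K0 AK]; split=> // w.
have := AK (tens_col w (delta_mx s 0)).
rewrite sqnorm_tens_col sqnorm_delta mulr1; apply: le_trans.
rewrite /sqnorm [leRHS]big_mxtens; apply: ler_sum => p _.
rewrite (bigD1 r)//=.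
have -> : (A *m tens_col w (delta_mx s 0)) (mxtens_index (p, r)) 0 =
    (mxslicel A r s *m w) p 0.
  rewrite !mxE big_mxtens; apply: eq_bigr => q _.
  rewrite (bigD1 s)//= big1 ?addr0 => [|t ts]; rewrite !mxE mxtens_indexK/=.
    by rewrite eqxx mulr1.
  by rewrite (negbTE ts)/= !mulr0.
by rewrite lerDl sumr_ge0// => k _; rewrite exprn_ge0.
Qed.

Lemma opnorm_le_slicer m n K (A : 'M[C]_(m * n)) p q :
  opnorm_le K A -> opnorm_le K (mxslicer A p q).
Proof.
move=> [K0 AK]; split=> // w.
have := AK (tens_col (delta_mx q 0) w).
rewrite sqnorm_tens_col sqnorm_delta mul1r; apply: le_trans.
rewrite /sqnorm [leRHS]big_mxtens (bigD1 p)//=.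
have -> : \sum_r `|(A *m tens_col (delta_mx q 0) w) (mxtens_index (p, r)) 0| ^+ 2 =
    \sum_r `|(mxslicer A p q *m w) r 0| ^+ 2.
  apply: eq_bigr => r _; congr (`|_| ^+ 2).
  rewrite !mxE big_mxtens (bigD1 q)//= [X in _ + X]big1 ?addr0 => [|t tq].
    by apply: eq_bigr => s _; rewrite !mxE mxtens_indexK/= eqxx mul1r.
  by rewrite big1// => s _; rewrite !mxE mxtens_indexK/= (negbTE tq) mul0r mulr0.
rewrite lerDl sumr_ge0// => k _; rewrite sumr_ge0// => l _.
by rewrite exprn_ge0.
Qed.

Lemma sqnorm_row_mul n (u z : 'cV[C]_n) :
  `|\sum_r (u r 0)^* * z r 0| ^+ 2 <= sqnorm u * sqnorm z.
Proof.
have uK : opnorm_le (sqrtC (sqnorm u)) u.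
  split=> [|v]; first by rewrite sqrtC_ge0 sqnorm_ge0.
  rewrite sqrtCK /sqnorm big_ord1 mulr_suml; apply: ler_sum => k _.
  by rewrite !mxE big_ord1 normrM exprMn.
have [_ /(_ z)] := opnorm_le_adj uK.
rewrite sqrtCK {1}/sqnorm big_ord1 mxE; congr (`|_| ^+ 2 <= _).
by apply: eq_bigr => r _; rewrite !mxE.
Qed.

(* (id (x) w)(A), for w(T) = <T v, u> *)
Lemma opnorm_le_slice_vec m n K (A : 'M[C]_(m * n)) (u v : 'cV[C]_n) :
  opnorm_le K A ->
  opnorm_le (sqrtC (sqnorm u * sqnorm v) * K)
    (\sum_r \sum_s ((u r 0)^* * v s 0) *: mxslicel A r s).
Proof.
move=> [K0 AK]; have uv0 : 0 <= sqnorm u * sqnorm v.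
  by rewrite mulr_ge0// sqnorm_ge0.
split=> [|w]; first by rewrite mulr_ge0// sqrtC_ge0.
rewrite exprMn sqrtCK; set z := A *m tens_col w v.
have zE p : ((\sum_r \sum_s ((u r 0)^* * v s 0) *: mxslicel A r s) *m w) p 0 =
    \sum_r (u r 0)^* * (\col_r z (mxtens_index (p, r)) 0) r 0.
  rewrite mulmx_suml summxE; apply: eq_bigr => r _.
  rewrite mulmx_suml summxE [in RHS]mxE /z [in RHS]mxE [in RHS]big_mxtens.
  rewrite [in RHS]exchange_big mulr_sumr; apply: eq_bigr => s _.
  rewrite -scalemxAl !mxE !mulr_sumr; apply: eq_bigr => q _.
  rewrite !mxE mxtens_indexK/=.
  by ring.
apply: (@le_trans _ _ (sqnorm u * sqnorm z)).
  rewrite {1}/sqnorm [in leRHS]/sqnorm big_mxtens mulr_sumr.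
  apply: ler_sum => p _; rewrite zE; apply: le_trans (sqnorm_row_mul _ _) _.
  apply: ler_wpM2l; first exact: sqnorm_ge0.
  by rewrite /sqnorm; apply: ler_sum => r _; rewrite mxE.
rewrite -[leRHS]mulrA -[leRHS]mulrA; apply: ler_wpM2l; first exact: sqnorm_ge0.
apply: le_trans (AK _) _; rewrite sqnorm_tens_col.
by have -> : K ^+ 2 * (sqnorm w * sqnorm v) =
  sqnorm v * (K ^+ 2 * sqnorm w) by ring.
Qed.

End TensorMatrices.

(* The von Neumann algebra l^oo-(+)_i M_{d i}(C). *)
Record linf (R : realType) (I : Type) (d : I -> nat) := Linf {
  block :> forall i, 'M[R[i]]_(d i);
  block_bounded : exists K, forall i, opnorm_le K (block i)
}.
Arguments Linf {R I d}.

Section BlockAlgebra.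
Variables (R : realType) (I : Type) (d : I -> nat).
Local Notation C := R[i].
Local Notation M := (linf R d).
Implicit Types x y : M.

Lemma linf_eq x y : (forall i, x i = y i) -> x = y.
Proof.
case: x y => [f fb] [g gb] /= fg.
have {}fg : f = g by apply: functional_extensionality_dep.
by rewrite fg in fb *; congr Linf; exact: Prop_irrelevance.
Qed.

HB.instance Definition _ := gen_eqMixin M.
HB.instance Definition _ := gen_choiceMixin M.

Fact linf0_subproof : exists K : C, forall i, opnorm_le K (0 : 'M[C]_(d i)).
Proof. by exists 0 => i; exact: opnorm_le0. Qed.
Definition linf0 : M := Linf _ linf0_subproof.

Fact linf1_subproof : exists K : C, forall i, opnorm_le K (1%:M : 'M[C]_(d i)).
Proof. by exists 1 => i; exact: opnorm_le1. Qed.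
Definition linf1 : M := Linf _ linf1_subproof.

Fact linfN_subproof x : exists K : C, forall i, opnorm_le K (- x i).
Proof. by have [K xK] := block_bounded x; exists K => i; exact: opnorm_leN. Qed.
Definition linfN x : M := Linf _ (linfN_subproof x).

Fact linfD_subproof x y : exists K : C, forall i, opnorm_le K (x i + y i).
Proof.
have [K xK] := block_bounded x; have [L yL] := block_bounded y.
by exists (2 * (K + L)) => i; exact: opnorm_leD.
Qed.
Definition linfD x y : M := Linf _ (linfD_subproof x y).

Fact linfM_subproof x y : exists K : C, forall i, opnorm_le K (x i *m y i).
Proof.
have [K xK] := block_bounded x; have [L yL] := block_bounded y.
by exists (K * L) => i; exact: opnorm_leM.
Qed.
Definition linfM x y : M := Linf _ (linfM_subproof x y).

Fact linfZ_subproof a x : exists K : C, forall i, opnorm_le K (a *: x i).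
Proof.
by have [K xK] := block_bounded x; exists (`|a| * K) => i; exact: opnorm_leZ.
Qed.
Definition linfZ a x : M := Linf _ (linfZ_subproof a x).

Fact linf_adj_subproof x : exists K : C, forall i, opnorm_le K ((x i)^t*).
Proof. by have [K xK] := block_bounded x; exists K => i; exact: opnorm_le_adj. Qed.
Definition linf_adj x : M := Linf _ (linf_adj_subproof x).

Fact linf_addA : associative linfD.
Proof. by move=> x y z; apply: linf_eq => i; exact: addrA. Qed.
Fact linf_addC : commutative linfD.
Proof. by move=> x y; apply: linf_eq => i; exact: addrC. Qed.
Fact linf_add0 : left_id linf0 linfD.
Proof. by move=> x; apply: linf_eq => i; exact: add0r. Qed.
Fact linf_addN : left_inverse linf0 linfN linfD.
Proof. by move=> x; apply: linf_eq => i; exact: addNr. Qed.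

HB.instance Definition _ :=
  GRing.isZmodule.Build M linf_addA linf_addC linf_add0 linf_addN.

Fact linf_mulA : associative linfM.
Proof. by move=> x y z; apply: linf_eq => i; exact: mulmxA. Qed.
Fact linf_mul1 : left_id linf1 linfM.
Proof. by move=> x; apply: linf_eq => i; exact: mul1mx. Qed.
Fact linf_mulr1 : right_id linf1 linfM.
Proof. by move=> x; apply: linf_eq => i; exact: mulmx1. Qed.
Fact linf_mulDl : left_distributive linfM +%R.
Proof. by move=> x y z; apply: linf_eq => i; exact: mulmxDl. Qed.
Fact linf_mulDr : right_distributive linfM +%R.
Proof. by move=> x y z; apply: linf_eq => i; exact: mulmxDr. Qed.

HB.instance Definition _ := GRing.Zmodule_isPzRing.Build M
  linf_mulA linf_mul1 linf_mulr1 linf_mulDl linf_mulDr.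

Fact linf_scaleA a b x : linfZ a (linfZ b x) = linfZ (a * b) x.
Proof. by apply: linf_eq => i; exact: scalerA. Qed.
Fact linf_scale1 : left_id 1 linfZ.
Proof. by move=> x; apply: linf_eq => i; exact: scale1r. Qed.
Fact linf_scaleDr : right_distributive linfZ +%R.
Proof. by move=> a x y; apply: linf_eq => i; exact: scalerDr. Qed.
Fact linf_scaleDl x : {morph linfZ^~ x : a b / a + b}.
Proof. by move=> a b; apply: linf_eq => i; exact: scalerDl. Qed.

HB.instance Definition _ := GRing.Zmodule_isLmodule.Build C M
  linf_scaleA linf_scale1 linf_scaleDr linf_scaleDl.

(* The C*-norm of x is at most K. *)
Definition linf_norm_le (K : C) x : Prop :=
  0 <= K /\ forall i, opnorm_le K (x i).

Definition linf_ge0 x : Prop :=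
  forall i (v : 'cV[C]_(d i)), 0 <= (v^t* *m x i *m v) 0 0.

(* Positivity in the C*-algebra M_N(M), acting on the sums of N copies of the
   spaces C^(d i). *)
Definition linf_mx_ge0 N (X : 'M[M]_N) : Prop :=
  forall i (v : 'I_N -> 'cV[C]_(d i)),
    0 <= \sum_a \sum_b ((v a)^t* *m X a b i *m v b) 0 0.

End BlockAlgebra.

(* A finitely supported family belongs to the algebraic direct sum of the
   blocks. *)
Definition finitely_supported (R : realType) (I : Type) (d : I -> nat)
    (x : forall i, 'M[R[i]]_(d i)) : Prop :=
  finite_set [set i | x i != 0].

Section Predual.
Variables (R : realType) (I : choiceType) (d : I -> nat).
Local Notation C := R[i].
Local Notation M := (linf R d).

Fact linf_cut_subproof (F : {fset I}) (x : M) :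
  exists K : C, forall i, opnorm_le K (if i \in F then x i else 0).
Proof.
have [K xK] := block_bounded x; exists K => i; case: ifP => // _.
by apply: opnorm_le_trans (opnorm_le0 _ _ _); case: (xK i).
Qed.

(* x times the central projection onto the blocks indexed by F *)
Definition linf_cut (F : {fset I}) (x : M) : M := Linf _ (linf_cut_subproof F x).

(* The predual, as the space of normal functionals: bounded ones which are completely additive on the
   direct sum, that is f(x) is the unconditional sum of the f(x_i). *)
Record l1 := L1 {
  l1_fun :> {scalar M};
  l1_bounded : exists2 c, 0 <= c &
    forall K x, linf_norm_le K x -> `|l1_fun x| <= c * K;
  l1_normal : forall x,
    l1_fun (linf_cut F x) @[F --> totally] --> (l1_fun x : C^o)
}.

Section Compression.
Variables (P : M) (f : l1).

Definition compress_fun (x : M) : C := f (P * x * P).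

Fact compress_linear : scalar compress_fun.
Proof.
move=> a x y; rewrite /compress_fun -linearP; congr (f _).
by apply: linf_eq => i /=; rewrite mulmxDr mulmxDl -scalemxAr -scalemxAl.
Qed.

HB.instance Definition _ :=
  GRing.isLinear.Build C M C *%R compress_fun compress_linear.

Fact compress_bounded :
  exists2 c, 0 <= c &
    forall K x, linf_norm_le K x -> `|compress_fun x| <= c * K.
Proof.
have [L PL] := block_bounded P; have [c c0 fc] := l1_bounded f.
exists (c * (`|L| * `|L|)) => [|K x [K0 xK]]; first by rewrite !mulr_ge0.
have -> : c * (`|L| * `|L|) * K = c * (`|L| * K * `|L|) by ring.
apply: fc; split=> [|i]; first by rewrite !mulr_ge0.
have PL' : opnorm_le `|L| (P i).
  by apply: opnorm_le_trans (PL i); rewrite real_ler_norm// ger0_real//; case: (PL i).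
by apply: opnorm_leM => //; exact: opnorm_leM.
Qed.

Fact compress_normal x :
  compress_fun (linf_cut F x) @[F --> totally] --> (compress_fun x : C^o).
Proof.
rewrite /compress_fun.
suff -> : (fun F => f (P * linf_cut F x * P)) =
    (fun F => f (linf_cut F (P * x * P))) by exact: l1_normal.
apply/funext => F; congr (f _).
by apply: linf_eq => i /=; case: ifP => // _; rewrite mulmx0 mul0mx.
Qed.

(* P f P *)
Definition compress : l1 := L1 compress_bounded compress_normal.

End Compression.
End Predual.

(* The von Neumann tensor product of two such algebras has the blocks
   M_{d i} (x) M_{e j} = M_{d i * e j}, identified by the Kronecker product. *)
Definition tdim (I J : Type) (d : I -> nat) (e : J -> nat) (k : I * J) : nat :=
  (d k.1 * e k.2)%N.

Section Tensor.
Variables (R : realType) (I J : choiceType) (d : I -> nat) (e : J -> nat).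
Local Notation C := R[i].
Implicit Types (X : linf R (tdim d e)).

Fact linf_tens_subproof (x : linf R d) (y : linf R e) :
  exists K : C, forall k, opnorm_le K (x k.1 *t y k.2 : 'M[C]_(tdim d e k)).
Proof.
have [K xK] := block_bounded x; have [L yL] := block_bounded y.
by exists (K * L) => k; exact: opnorm_le_tens.
Qed.
Definition linf_tens (x : linf R d) (y : linf R e) : linf R (tdim d e) :=
  Linf _ (linf_tens_subproof x y).

Fact linf_slicel_subproof X j (r s : 'I_(e j)) : exists K : C, forall i : I,
  opnorm_le K (mxslicel (X (i, j)) r s).
Proof.
have [K XK] := block_bounded X.
by exists K => i; apply: opnorm_le_slicel; exact: XK.
Qed.
(* (id (x) w)(X), for w the (r, s) entry of the block j *)
Definition linf_slicel X j (r s : 'I_(e j)) : linf R d :=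
  Linf _ (linf_slicel_subproof X r s).

Fact linf_slicer_subproof X i (p q : 'I_(d i)) : exists K : C, forall j : J,
  opnorm_le K (mxslicer (X (i, j)) p q).
Proof.
have [K XK] := block_bounded X.
by exists K => j; apply: opnorm_le_slicer; exact: XK.
Qed.
(* (w (x) id)(X), for w the (p, q) entry of the block i *)
Definition linf_slicer X i (p q : 'I_(d i)) : linf R e :=
  Linf _ (linf_slicer_subproof X p q).

Fact l1_slice_subproof (f : l1 R d) X : exists K : C, forall j : J,
  opnorm_le K (\matrix_(r < e j, s < e j) f (linf_slicel X r s)).
Proof.
have [K XK] := block_bounded X; have [c c0 fc] := l1_bounded f.
have [j0|noj] := pselect (inhabited J); last first.
  by exists 0 => j; case: noj; exists.
have [i0|noi] := pselect (inhabited I); last first.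
  exists 0 => j; have -> : \matrix_(r < e j, s < e j) f (linf_slicel X r s) = 0.
    apply/matrixP => r s; rewrite !mxE (_ : linf_slicel X r s = 0) ?linear0//.
    by apply: linf_eq => i; case: noi; exists.
  exact: opnorm_le0.
case: j0 i0 => [j0] [i0]; have K0 : 0 <= K by case: (XK (i0, j0)).
exists (c * K) => j; split=> [|v]; first by rewrite mulr_ge0.
set u := _ *m v; pose Y := \sum_r \sum_s ((u r 0)^* * v s 0) *: linf_slicel X r s.
have fY : f Y = sqnorm u.
  rewrite /Y linear_sum /sqnorm; apply: eq_bigr => r _.
  rewrite linear_sum normCK mulrC {2}/u mxE mulr_sumr; apply: eq_bigr => s _.
  by rewrite linearZ/= !mxE; ring.
have Yi i : Y i = \sum_r \sum_s ((u r 0)^* * v s 0) *: mxslicel (X (i, j)) r s.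
  have blockD (x y : linf R d) : (x + y) i = x i + y i by [].
  have blocks (T : finType) (F : T -> linf R d) : (\sum_t F t) i = \sum_t F t i.
    exact: (@big_morph _ _ (fun x : linf R d => x i) 0 +%R 0 +%R blockD).
  by rewrite /Y blocks; apply: eq_bigr => r _; rewrite blocks.
have YK : linf_norm_le (sqrtC (sqnorm u * sqnorm v) * K) Y.
  split=> [|i]; first by rewrite mulr_ge0// sqrtC_ge0 mulr_ge0// sqnorm_ge0.
  by rewrite Yi; apply: opnorm_le_slice_vec; exact: (XK (i, j)).
have u0 := sqnorm_ge0 u; have v0 := sqnorm_ge0 v.
have := fc _ _ YK; rewrite fY ger0_norm// => h.
have h2 : sqnorm u * sqnorm u <= sqnorm u * ((c * K) ^+ 2 * sqnorm v).
  have -> : sqnorm u * ((c * K) ^+ 2 * sqnorm v) =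
      (c * (sqrtC (sqnorm u * sqnorm v) * K)) ^+ 2.
    by rewrite !exprMn sqrtCK; ring.
  by rewrite -expr2 lerXn2r// nnegrE// !mulr_ge0// sqrtC_ge0 mulr_ge0.
have [->|un0] := eqVneq (sqnorm u) 0; first by rewrite mulr_ge0// exprn_ge0// mulr_ge0.
by rewrite -(ler_pM2l (x := sqnorm u)) // lt_neqAle eq_sym un0.
Qed.

(* (f (x) id)(X) *)
Definition l1_slice (f : l1 R d) X : linf R e := Linf _ (l1_slice_subproof f X).

End Tensor.

(* The discrete quantum groups of Van Daele: multiplier Hopf *-algebras whose
   underlying *-algebra is a direct sum A of full matrix algebras. The
   coproduct is given on the multipliers l^oo of A instead of A, as the (unique)
   normal unital *-homomorphism that extends it. *)

Section Coproduct.
Variables (R : realType) (I : choiceType) (d : I -> nat).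
Variable D : linf R d -> linf R (tdim d d).
Local Notation C := R[i].
Implicit Types X : linf R (tdim d d).

(* (D (x) id)(X) *)
Definition comul_id X (k : (I * I) * I) : 'M[C]_(tdim (tdim d d) d k) :=
  \sum_r \sum_s D (linf_slicel X r s) k.1 *t delta_mx r s.

(* (id (x) D)(X) *)
Definition id_comul X (k : I * (I * I)) : 'M[C]_(tdim d (tdim d d) k) :=
  \sum_p \sum_q delta_mx p q *t D (linf_slicer X p q) k.2.

(* The linear extension of a (x) b |-> D(a) (1 (x) b): as 1 (x) b only meets
   the blocks (i, j) with b_j <> 0, the block (i, j) of the image only depends
   on the slices of X at j. *)
Definition galois_r X (k : I * I) : 'M[C]_(tdim d d k) :=
  \sum_r \sum_s D (linf_slicel X r s) k *m (1%:M *t delta_mx r s).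

(* The linear extension of a (x) b |-> (a (x) 1) D(b) *)
Definition galois_l X (k : I * I) : 'M[C]_(tdim d d k) :=
  \sum_p \sum_q (delta_mx p q *t 1%:M) *m D (linf_slicer X p q) k.

End Coproduct.

Record discrete_quantum_group (R : realType) := DiscreteQuantumGroup {
  irr : choiceType;
  irr_dim : irr -> nat;
  irr_dim_gt0 : forall i, (0 < irr_dim i)%N;
  comul : {linear linf R irr_dim -> linf R (tdim irr_dim irr_dim)};
  comul1 : comul 1 = 1;
  comulM : forall x y, comul (x * y) = comul x * comul y;
  comul_adj : forall x, comul (linf_adj x) = linf_adj (comul x);
  comul_normal : forall g : l1 R (tdim irr_dim irr_dim),
    exists f : l1 R irr_dim, forall x, f x = g (comul x);
  comul_coassoc : forall x i j k,
    comul_id comul (comul x) ((i, j), k) =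
    castmx (mulnA (irr_dim i) (irr_dim j) (irr_dim k),
            mulnA (irr_dim i) (irr_dim j) (irr_dim k))
      (id_comul comul (comul x) (i, (j, k)));
  galois_r_bij : set_bij
    [set X : linf R (tdim irr_dim irr_dim) | finitely_supported X]
    [set Y | finitely_supported Y] (galois_r comul);
  galois_l_bij : set_bij
    [set X : linf R (tdim irr_dim irr_dim) | finitely_supported X]
    [set Y | finitely_supported Y] (galois_l comul)
}.

Arguments irr_dim {R} G i : rename.
Arguments comul {R} G : rename.

Section Amenability.
Variables (R : realType) (G : discrete_quantum_group R).
Local Notation C := R[i].
Local Notation M := (linf R (irr_dim G)).
Implicit Types (P x : M) (f : l1 R (irr_dim G)).

(* x * f *)
Definition ract x f : M := l1_slice f (comul G x).

(* f * m *)
Definition lact f (m : M -> C) x : C := m (ract x f).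

Definition group_like_projection P : Prop :=
  [/\ linf_adj P = P, P * P = P &
      linf_tens 1 P * comul G P = linf_tens P P].

Definition M_ P : set (M) :=
  [set x | linf_tens 1 P * comul G x * linf_tens 1 P = linf_tens x P].

Definition completely_positive (E : M -> M) : Prop :=
  forall N (X : 'M[M]_N), linf_mx_ge0 X -> linf_mx_ge0 (map_mx E X).

(* Meant for weak* closed subspaces X that are right invariant. *)
Definition amenable (X : set (M)) : Prop :=
  exists E : {linear M -> M},
    [/\ E 1 = 1, completely_positive E,
        forall x f, E (ract x f) = ract (E x) f,
        forall x, E (E x) = E x &
        range E = X].

Definition state (m : {scalar M}) : Prop :=
  m 1 = 1 /\ forall x, linf_ge0 x -> 0 <= m x.

End Amenability.

(* Main.v *)
Require Import Defs.
From HB Require Import structures.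
From mathcomp Require Import all_boot all_order all_algebra finmap ring lra.
From mathcomp Require Import spectral complex mxtens.
From mathcomp Require Import boolp classical_sets cardinality.
From mathcomp Require Import reals topology normedtype summability.

Set Implicit Arguments.
Unset Strict Implicit.
Unset Printing Implicit Defensive.

Import Order.TTheory GRing.Theory Num.Theory.
Import numFieldNormedType.Exports.

Local Open Scope classical_set_scope.
Local Open Scope ring_scope.
Local Open Scope sesquilinear_scope.

(** Write [D] for the coproduct.

    From a projection [E] onto [M_P] to a state. Applying the counit to the
    first leg of [(1 (x) P)D(y)(1 (x) P) = y (x) P] shows that [PyP] is a
    multiple [chi(y)P] of [P] for [y] in [M_P] ([M_P_compression]). The
    functional [chi o E] is a state, equals [1] at [P] since [P] lies in [M_P],
    and its invariance is the module property of [E] compressed by [P]. The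
    counit is extracted from the Galois maps ([counit_exists]), as a functional
    on the finitely supported elements.

    From a state [m] to a projection. Cut [m] down to [m'(x) = m(PxP) / m(P)]
    and put [E = (id (x) m') o D]. If [m'] is still invariant, then
    [P E(x) P = m'(x)P], and slicing [D(E x)] puts [E x] in [M_P]; on [M_P] the
    functional [m'] is the counit, so that [E] fixes [M_P].

    The invariance of [m'] ([invariant_compress]) is the heart of the matter.
    For a subgroup it follows from the existence of inverses, which for a
    projection reads [D(P)(P (x) 1) = P (x) P]; the definition of a group-like
    projection provides this identity for [1 (x) P] instead of [P (x) 1]. The
    invariance of [m] makes up for the difference: evaluated at [P] it says
    that the defect in the identity is null for [m], and the Cauchy-Schwarz
    inequality then removes the defect from every other evaluation.

    The remaining work is analytic, because [m'] is positive but not normal.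
    The slice [id (x) m'] is bounded by Cauchy-Schwarz; [E] is completely
    positive because positive matrices are Gram matrices ([linf_mx_gram]); and
    [E] is a module map because [m'] commutes with normal functionals
    ([l1_fubini]), which are uniformly small off finitely many blocks
    ([l1_tail]). *)

(** * Slices of tensor products *)

Section MatrixSlices.
Variable R : realType.
Local Notation C := R[i].

Lemma mxslicelE m n (A : 'M[C]_(m * n)) r s p q :
  mxslicel A r s p q = A (mxtens_index (p, r)) (mxtens_index (q, s)).
Proof. by rewrite mxE. Qed.

Lemma mxslicerE m n (A : 'M[C]_(m * n)) p q r s :
  mxslicer A p q r s = A (mxtens_index (p, r)) (mxtens_index (q, s)).
Proof. by rewrite mxE. Qed.

Lemma mxslicelM m n (A B : 'M[C]_(m * n)) r s :
  mxslicel (A *m B) r s = \sum_t mxslicel A r t *m mxslicel B t s.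
Proof.
apply/matrixP => p q; rewrite summxE !mxE big_mxtens exchange_big/=.
by apply: eq_bigr => t _; rewrite mxE; apply: eq_bigr => u _; rewrite !mxE.
Qed.

Lemma mxslicerM m n (A B : 'M[C]_(m * n)) p q :
  mxslicer (A *m B) p q = \sum_t mxslicer A p t *m mxslicer B t q.
Proof.
apply/matrixP => r s; rewrite summxE !mxE big_mxtens/=.
by apply: eq_bigr => t _; rewrite mxE; apply: eq_bigr => u _; rewrite !mxE.
Qed.

Lemma mxslicel_tens m n (A : 'M[C]_m) (B : 'M[C]_n) r s :
  mxslicel (A *t B) r s = B r s *: A.
Proof. by apply/matrixP => p q; rewrite mxslicelE tensmxE mxE mulrC. Qed.

Lemma mxslicer_tens m n (A : 'M[C]_m) (B : 'M[C]_n) p q :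
  mxslicer (A *t B) p q = A p q *: B.
Proof. by apply/matrixP => r s; rewrite mxslicerE tensmxE mxE. Qed.

Lemma mxslicel_adj m n (A : 'M[C]_(m * n)) r s :
  mxslicel (A^t*) r s = (mxslicel A s r)^t*.
Proof. by apply/matrixP => p q; rewrite !mxE. Qed.

Lemma mxslicer_adj m n (A : 'M[C]_(m * n)) p q :
  mxslicer (A^t*) p q = (mxslicer A q p)^t*.
Proof. by apply/matrixP => r s; rewrite !mxE. Qed.

Lemma eq_mxslicel m n (A B : 'M[C]_(m * n)) :
  (forall r s, mxslicel A r s = mxslicel B r s) -> A = B.
Proof.
move=> AB; apply/matrixP => k l.
case: (mxtens_indexP k) => p r; case: (mxtens_indexP l) => q s.
by have /matrixP/(_ p q) := AB r s; rewrite !mxslicelE.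
Qed.

Lemma eq_mxslicer m n (A B : 'M[C]_(m * n)) :
  (forall p q, mxslicer A p q = mxslicer B p q) -> A = B.
Proof.
move=> AB; apply/matrixP => k l.
case: (mxtens_indexP k) => p r; case: (mxtens_indexP l) => q s.
by have /matrixP/(_ r s) := AB p q; rewrite !mxslicerE.
Qed.

End MatrixSlices.

Section SlicesOfSums.
Variables (R : realType) (m n : nat).
Local Notation C := R[i].

Lemma mxslicelD r s :
  {morph (fun A : 'M[C]_(m * n) => mxslicel A r s) : A B / A + B}.
Proof. by move=> A B; apply/matrixP => p q; rewrite !mxE. Qed.

Lemma mxslicerD p q :
  {morph (fun A : 'M[C]_(m * n) => mxslicer A p q) : A B / A + B}.
Proof. by move=> A B; apply/matrixP => r s; rewrite !mxE. Qed.

Lemma mxslicel0 r s : mxslicel (0 : 'M[C]_(m * n)) r s = 0.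
Proof. by apply/matrixP => p q; rewrite !mxE. Qed.

Lemma mxslicer0 p q : mxslicer (0 : 'M[C]_(m * n)) p q = 0.
Proof. by apply/matrixP => r s; rewrite !mxE. Qed.

Lemma mxslicel_sum_delta (F : 'I_n -> 'I_n -> 'M[C]_m) r s :
  mxslicel (\sum_t \sum_u F t u *t delta_mx t u) r s = F r s.
Proof.
apply/matrixP => p q.
rewrite mxslicelE summxE (bigD1 r)//= [X in _ + X]big1 => [|t tr].
  rewrite summxE (bigD1 s)//= big1 => [|u us].
    by rewrite tensmxE mxE !eqxx mulr1 !addr0.
  by rewrite tensmxE mxE eq_sym (negbTE us) andbF mulr0.
by rewrite summxE big1// => u _; rewrite tensmxE mxE eq_sym (negbTE tr) mulr0.
Qed.

Lemma mxslicer_sum_delta (F : 'I_m -> 'I_m -> 'M[C]_n) p q :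
  mxslicer (\sum_t \sum_u delta_mx t u *t F t u) p q = F p q.
Proof.
apply/matrixP => r s.
rewrite mxslicerE summxE (bigD1 p)//= [X in _ + X]big1 => [|t tp].
  rewrite summxE (bigD1 q)//= big1 => [|u uq].
    by rewrite tensmxE mxE !eqxx mul1r !addr0.
  by rewrite tensmxE mxE eq_sym (negbTE uq) andbF mul0r.
by rewrite summxE big1// => u _; rewrite tensmxE mxE eq_sym (negbTE tp) mul0r.
Qed.

End SlicesOfSums.

Section BlockAlgebraTheory.
Variables (R : realType) (I : Type) (d : I -> nat).
Local Notation C := R[i].
Local Notation M := (linf R d).
Implicit Types x y : M.

Lemma linfDE x y i : (x + y) i = x i + y i. Proof. by []. Qed.
Lemma linfNE x i : (- x) i = - x i. Proof. by []. Qed.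
Lemma linfME x y i : (x * y) i = x i *m y i. Proof. by []. Qed.
Lemma linfZE a x i : (a *: x) i = a *: x i. Proof. by []. Qed.
Lemma linf1E i : (1 : M) i = 1%:M. Proof. by []. Qed.
Lemma linf_adjE x i : linf_adj x i = (x i)^t*. Proof. by []. Qed.

Lemma linf_sumE (T : Type) (r : seq T) (Q : pred T) (F : T -> M) i :
  (\sum_(t <- r | Q t) F t) i = \sum_(t <- r | Q t) F t i.
Proof. exact: (big_morph (fun x : M => x i) (fun x y => linfDE x y i)). Qed.

Lemma linf_scalerAl a x y : (a *: x) * y = a *: (x * y).
Proof. by apply: linf_eq => i; rewrite linfME !linfZE scalemxAl. Qed.

Lemma linf_scalerAr a x y : x * (a *: y) = a *: (x * y).
Proof. by apply: linf_eq => i; rewrite linfME !linfZE scalemxAr. Qed.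

Lemma linf_adjK x : linf_adj (linf_adj x) = x.
Proof. by apply: linf_eq => i; exact: adjmxK. Qed.

Lemma linf_adjM x y : linf_adj (x * y) = linf_adj y * linf_adj x.
Proof. by apply: linf_eq => i; exact: adjmxM. Qed.

Lemma linf_adjB x y : linf_adj (x - y) = linf_adj x - linf_adj y.
Proof.
by apply: linf_eq => i; apply/matrixP => p q; rewrite !mxE rmorphB.
Qed.

Lemma linf_adjD x y : linf_adj (x + y) = linf_adj x + linf_adj y.
Proof.
by apply: linf_eq => i; apply/matrixP => p q; rewrite !mxE rmorphD.
Qed.

Lemma linf_adjZ a x : linf_adj (a *: x) = a^* *: linf_adj x.
Proof.
by apply: linf_eq => i; apply/matrixP => p q; rewrite !mxE rmorphM.
Qed.

Lemma linf_adj1 : linf_adj (1 : M) = 1.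
Proof. by apply: linf_eq => i; rewrite linf_adjE linf1E trmx1 map_mx1. Qed.

Lemma linf_adj_sum (T : Type) (r : seq T) (Q : pred T) (F : T -> M) :
  linf_adj (\sum_(t <- r | Q t) F t) = \sum_(t <- r | Q t) linf_adj (F t).
Proof.
apply: (big_morph (@linf_adj R I d)) => [x y|]; first exact: linf_adjD.
by have := linf_adjB 1 1; rewrite !subrr.
Qed.

Lemma form_adj_mul x i (v : 'cV[C]_(d i)) :
  (v^t* *m (linf_adj x * x) i *m v) 0 0 = sqnorm (x i *m v).
Proof. by rewrite linfME linf_adjE !mulmxA -adjmxM -mulmxA -sqnormE. Qed.

Lemma linf_adj_mul_ge0 x : linf_ge0 (linf_adj x * x).
Proof. by move=> i v; rewrite form_adj_mul sqnorm_ge0. Qed.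

Lemma linf_ge0_conj x z : linf_ge0 x -> linf_ge0 (linf_adj z * x * z).
Proof.
move=> x0 i v; have := x0 i (z i *m v).
by rewrite adjmxM !linfME linf_adjE !mulmxA.
Qed.

End BlockAlgebraTheory.

Section TensorTheory.
Variables (R : realType) (I J : choiceType) (d : I -> nat) (e : J -> nat).
Local Notation C := R[i].
Implicit Types (X Y : linf R (tdim d e)).

Lemma linf_slicelE X j (r s : 'I_(e j)) i :
  linf_slicel X r s i = mxslicel (X (i, j)) r s.
Proof. by []. Qed.

Lemma linf_slicerE X i (p q : 'I_(d i)) j :
  linf_slicer X p q j = mxslicer (X (i, j)) p q.
Proof. by []. Qed.

Lemma linf_slicelP a X Y j (r s : 'I_(e j)) :
  linf_slicel (a *: X + Y) r s = a *: linf_slicel X r s + linf_slicel Y r s.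
Proof. by apply: linf_eq => i; apply/matrixP => p q; rewrite !mxE. Qed.

Lemma linf_slicel_sum (T : Type) (s : seq T) (F : T -> linf R (tdim d e)) j
    (r u : 'I_(e j)) :
  linf_slicel (\sum_(t <- s) F t) r u = \sum_(t <- s) linf_slicel (F t) r u.
Proof.
apply: (big_morph (fun X => linf_slicel X r u)) => [X Y|].
  by have := linf_slicelP 1 X Y r u; rewrite !scale1r.
by apply: linf_eq => i; apply/matrixP => p q; rewrite !mxE.
Qed.

Lemma linf_slicerP a X Y i (p q : 'I_(d i)) :
  linf_slicer (a *: X + Y) p q = a *: linf_slicer X p q + linf_slicer Y p q.
Proof. by apply: linf_eq => j; apply/matrixP => r s; rewrite !mxE. Qed.

Lemma linf_slicelM X Y j (r s : 'I_(e j)) :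
  linf_slicel (X * Y) r s = \sum_t linf_slicel X r t * linf_slicel Y t s.
Proof. by apply: linf_eq => i; rewrite linf_sumE; exact: mxslicelM. Qed.

Lemma linf_slicerM X Y i (p q : 'I_(d i)) :
  linf_slicer (X * Y) p q = \sum_t linf_slicer X p t * linf_slicer Y t q.
Proof. by apply: linf_eq => j; rewrite linf_sumE; exact: mxslicerM. Qed.

Lemma linf_slicel_tens (a : linf R d) (b : linf R e) j (r s : 'I_(e j)) :
  linf_slicel (linf_tens a b) r s = b j r s *: a.
Proof. by apply: linf_eq => i; exact: mxslicel_tens. Qed.

Lemma linf_slicer_tens (a : linf R d) (b : linf R e) i (p q : 'I_(d i)) :
  linf_slicer (linf_tens a b) p q = a i p q *: b.
Proof. by apply: linf_eq => j; exact: mxslicer_tens. Qed.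

Lemma linf_slicel_adj X j (r s : 'I_(e j)) :
  linf_slicel (linf_adj X) r s = linf_adj (linf_slicel X s r).
Proof. by apply: linf_eq => i; exact: mxslicel_adj. Qed.

Lemma linf_slicer_adj X i (p q : 'I_(d i)) :
  linf_slicer (linf_adj X) p q = linf_adj (linf_slicer X q p).
Proof. by apply: linf_eq => j; exact: mxslicer_adj. Qed.

Lemma eq_linf_slicel X Y :
  (forall j (r s : 'I_(e j)), linf_slicel X r s = linf_slicel Y r s) -> X = Y.
Proof.
move=> XY; apply: linf_eq => -[i j]; apply: eq_mxslicel => r s.
by have /(congr1 (fun x : linf R d => x i)) := XY j r s.
Qed.

Lemma eq_linf_slicer X Y :
  (forall i (p q : 'I_(d i)), linf_slicer X p q = linf_slicer Y p q) -> X = Y.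
Proof.
move=> XY; apply: linf_eq => -[i j]; apply: eq_mxslicer => r s.
by have /(congr1 (fun x : linf R e => x j)) := XY i r s.
Qed.

Lemma linf_tensM (a1 a2 : linf R d) (b1 b2 : linf R e) :
  linf_tens a1 b1 * linf_tens a2 b2 = linf_tens (a1 * a2) (b1 * b2).
Proof.
apply: eq_linf_slicel => j r s.
rewrite linf_slicelM linf_slicel_tens linfME mxE.
rewrite scaler_suml; apply: eq_bigr => t _.
by rewrite !linf_slicel_tens linf_scalerAl linf_scalerAr scalerA.
Qed.

Lemma linf_adj_tens (a : linf R d) (b : linf R e) :
  linf_adj (linf_tens a b) = linf_tens (linf_adj a) (linf_adj b).
Proof.
apply: eq_linf_slicel => j r s.
by rewrite linf_slicel_adj !linf_slicel_tens linf_adjZ !mxE.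
Qed.

Lemma linf_tens11 : linf_tens (1 : linf R d) (1 : linf R e) = 1.
Proof.
apply: eq_linf_slicel => j r s; rewrite linf_slicel_tens.
apply: linf_eq => i; apply/matrixP => p q; rewrite linfZE !linf1E !mxE.
rewrite (inj_eq (can_inj (@mxtens_indexK _ _))) xpair_eqE.
by case: (p == q); case: (r == s); rewrite ?mulr1 ?mulr0.
Qed.

Lemma linf_slicel_mul1 b1 b2 X j (r s : 'I_(e j)) :
  linf_slicel (linf_tens 1 b1 * X * linf_tens 1 b2) r s =
  \sum_t \sum_u (b1 j r t * b2 j u s) *: linf_slicel X t u.
Proof.
rewrite linf_slicelM exchange_big; apply: eq_bigr => u _.
rewrite linf_slicelM mulr_suml; apply: eq_bigr => t _.
by rewrite !linf_slicel_tens !linf_scalerAl linf_scalerAr mul1r mulr1 scalerA.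
Qed.

Lemma linf_slicer_mul1 b1 b2 X i (p q : 'I_(d i)) :
  linf_slicer (linf_tens 1 b1 * X * linf_tens 1 b2) p q =
  b1 * linf_slicer X p q * b2.
Proof.
rewrite linf_slicerM (bigD1 q)//= big1 ?addr0 => [|t tq]; last first.
  by rewrite [X in _ * X]linf_slicer_tens linf1E mxE (negbTE tq) scale0r mulr0.
rewrite linf_slicer_tens linf1E mxE eqxx scale1r; congr (_ * _).
rewrite linf_slicerM (bigD1 p)//= big1 ?addr0 => [|t tp]; last first.
  by rewrite linf_slicer_tens linf1E mxE eq_sym (negbTE tp) scale0r mul0r.
by rewrite linf_slicer_tens linf1E mxE eqxx scale1r.
Qed.

Lemma linf_slicel_mul2 a1 a2 X j (r s : 'I_(e j)) :
  linf_slicel (linf_tens a1 1 * X * linf_tens a2 1) r s =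
  a1 * linf_slicel X r s * a2.
Proof.
rewrite linf_slicelM (bigD1 s)//= big1 ?addr0 => [|t tq]; last first.
  by rewrite [X in _ * X]linf_slicel_tens linf1E mxE (negbTE tq) scale0r mulr0.
rewrite linf_slicel_tens linf1E mxE eqxx scale1r; congr (_ * _).
rewrite linf_slicelM (bigD1 r)//= big1 ?addr0 => [|t tp]; last first.
  by rewrite linf_slicel_tens linf1E mxE eq_sym (negbTE tp) scale0r mul0r.
by rewrite linf_slicel_tens linf1E mxE eqxx scale1r.
Qed.

End TensorTheory.

(** * Normal functionals *)

Section Estimates.
Variable R : realType.
Local Notation C := R[i].

Lemma opnorm_le_delta m n (p : 'I_m) (q : 'I_n) :
  opnorm_le 1 (delta_mx p q : 'M[C]_(m, n)).
Proof.
split=> // v; rewrite expr1n mul1r /sqnorm (bigD1 p)//= big1 => [|r rp].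
  rewrite addr0 mxE (bigD1 q)//= big1 => [|s sq]; last first.
    by rewrite mxE eqxx (negbTE sq) mul0r.
  rewrite mxE !eqxx mul1r addr0 (bigD1 q)//= lerDl.
  by apply: sumr_ge0 => k _; rewrite exprn_ge0.
rewrite mxE big1 ?normr0 ?expr0n// => s _.
by rewrite mxE (negbTE rp) mul0r.
Qed.

Lemma sqnorm_eq0 n (v : 'cV[C]_n) : sqnorm v = 0 -> v = 0.
Proof.
move=> /eqP; rewrite psumr_eq0; last by move=> k _; rewrite exprn_ge0.
move=> /allP v0; apply/colP => k; rewrite [RHS]mxE; apply/eqP.
by have := v0 k (mem_index_enum _); rewrite /= expf_eq0 normr_eq0.
Qed.

(** The matrix [A] is tested against [u = A v]. *)
Lemma opnorm_le_form m n K (A : 'M[C]_(m, n)) : 0 <= K ->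
  (forall (u : 'cV[C]_m) (v : 'cV[C]_n),
     `|\sum_r \sum_s (u r 0)^* * v s 0 * A r s| <=
     K * sqrtC (sqnorm u * sqnorm v)) ->
  opnorm_le K A.
Proof.
move=> K0 AK; split=> // v; set u := A *m v.
have := AK u v.
have -> : \sum_r \sum_s (u r 0)^* * v s 0 * A r s = sqnorm u.
  apply: eq_bigr => r _; rewrite normCK mulrC {2}/u mxE mulr_sumr.
  by apply: eq_bigr => s _; ring.
have u0 := sqnorm_ge0 u; have v0 := sqnorm_ge0 v.
rewrite ger0_norm// => h.
have h2 : sqnorm u * sqnorm u <= sqnorm u * (K ^+ 2 * sqnorm v).
  have -> : sqnorm u * (K ^+ 2 * sqnorm v) =
      (K * sqrtC (sqnorm u * sqnorm v)) ^+ 2.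
    by rewrite !exprMn sqrtCK; ring.
  by rewrite -expr2 lerXn2r// nnegrE// !mulr_ge0// sqrtC_ge0 mulr_ge0.
have [->|un0] := eqVneq (sqnorm u) 0; first by rewrite mulr_ge0// exprn_ge0.
by rewrite -(ler_pM2l (x := sqnorm u)) // lt_neqAle eq_sym un0.
Qed.

Lemma formE m n (A : 'M[C]_(m, n)) (u : 'cV_m) (v : 'cV_n) :
  (u^t* *m A *m v) 0 0 = \sum_r \sum_s (u r 0)^* * v s 0 * A r s.
Proof.
rewrite -mulmxA mxE; apply: eq_bigr => r _; rewrite !mxE mulr_sumr.
by apply: eq_bigr => s _; ring.
Qed.

Lemma norm_form_le m n K (A : 'M[C]_(m, n)) (u : 'cV_m) (v : 'cV_n) :
  opnorm_le K A ->
  `|(u^t* *m A *m v) 0 0| ^+ 2 <= K ^+ 2 * (sqnorm u * sqnorm v).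
Proof.
move=> [K0 AK]; rewrite -mulmxA mxE.
rewrite (eq_bigr (fun r => (u r 0)^* * (A *m v) r 0)) => [|r _]; last first.
  by rewrite !mxE.
apply: le_trans (sqnorm_row_mul u (A *m v)) _.
rewrite mulrCA.
by apply: ler_wpM2l; [exact: sqnorm_ge0 | exact: AK].
Qed.

Lemma eq0_of_small (D B : C) : 0 <= B ->
  (forall e, 0 < e -> `|D| <= e * B) -> D = 0.
Proof.
move=> B0 DB; apply/eqP; rewrite -normr_eq0; apply/negPn/negP => D0.
have Dp : 0 < `|D| by rewrite lt_neqAle eq_sym D0 normr_ge0.
have B1 : 0 < B + 1 by rewrite ltr_wpDl.
have := DB (`|D| / (2 * (B + 1))).
rewrite divr_gt0 ?mulr_gt0// => /(_ isT); rewrite -mulrA.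
rewrite -[leLHS]mulr1 ler_pM2l// ler_pdivlMl ?mulr_gt0// mulr1 => h.
have : B + 1 <= B.
  apply: le_trans h; rewrite -[leLHS]mul1r ler_pM2r//.
  by rewrite ler1n.
by rewrite gerDl ler10.
Qed.

End Estimates.

Section Functionals.
Variables (R : realType) (I : choiceType) (d : I -> nat).
Local Notation C := R[i].
Local Notation M := (linf R d).
Implicit Types (f : l1 R d) (x y : M).

Fact linf_unit_subproof i (p q : 'I_(d i)) : exists K : C, forall l, opnorm_le K
  (\matrix_(r < d l, s < d l)
    [&& l == i, r == p :> nat & s == q :> nat]%:R : 'M[C]_(d l)).
Proof.
exists 1 => l; have [li|li] := eqVneq l i; last first.
  rewrite [X in opnorm_le _ X](_ : _ = 0); last first.
    by apply/matrixP => r s; rewrite !mxE.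
  by apply: opnorm_le_trans (opnorm_le0 _ _ _).
rewrite li in p q *.
rewrite [X in opnorm_le _ X](_ : _ = delta_mx p q); last first.
  by apply/matrixP => r s; rewrite !mxE.
exact: opnorm_le_delta.
Qed.

(** The matrix unit of the block [i]; the indices are compared as natural
    numbers because the formula has to make sense in every block. *)
Definition linf_unit i (p q : 'I_(d i)) : M := Linf _ (linf_unit_subproof p q).

Lemma linf_unitE i (p q : 'I_(d i)) : linf_unit p q i = delta_mx p q.
Proof. by apply/matrixP => r s; rewrite !mxE eqxx. Qed.

Lemma linf_unit_neq i l (p q : 'I_(d i)) : l != i -> linf_unit p q l = 0.
Proof. by move=> li; apply/matrixP => r s; rewrite !mxE (negbTE li). Qed.

Lemma linf_cut_sum (F : {fset I}) x :
  linf_cut F x = \sum_(i <- F) \sum_p \sum_q x i p q *: linf_unit p q.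
Proof.
apply: linf_eq => l; rewrite linf_sumE.
have unitl : (\sum_p \sum_q x l p q *: linf_unit p q) l = x l.
  rewrite linf_sumE [RHS]matrix_sum_delta; apply: eq_bigr => p _.
  rewrite linf_sumE; apply: eq_bigr => q _.
  by rewrite linfZE linf_unitE.
have unitn i : i != l -> (\sum_p \sum_q x i p q *: linf_unit p q) l = 0.
  move=> il; rewrite linf_sumE big1// => p _; rewrite linf_sumE big1// => q _.
  by rewrite linfZE linf_unit_neq 1?eq_sym// scaler0.
rewrite /=; case: ifPn => lF.
  rewrite (big_fsetD1 l)//= unitl big_seq big1 ?addr0// => i.
  by rewrite in_fsetD1 => /andP[il _]; exact: unitn.
rewrite big_seq big1// => i iF; apply: unitn.
by apply: contraNneq lF => <-.
Qed.

Section VectorFunctional.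
Variables (i : I) (u v : 'cV[C]_(d i)).

Definition vector_fun (x : M) : C := (u^t* *m x i *m v) 0 0.

Fact vector_fun_linear : scalar vector_fun.
Proof.
move=> a x y; rewrite /vector_fun linfDE linfZE mulmxDr mulmxDl.
by rewrite -scalemxAr -scalemxAl !mxE.
Qed.

HB.instance Definition _ :=
  GRing.isLinear.Build C M C *%R vector_fun vector_fun_linear.

Fact vector_fun_bounded : exists2 c, 0 <= c &
  forall K x, linf_norm_le K x -> `|vector_fun x| <= c * K.
Proof.
have uv0 : 0 <= sqnorm u * sqnorm v by rewrite mulr_ge0// sqnorm_ge0.
exists (sqrtC (sqnorm u * sqnorm v)) => [|K x [K0 xK]].
  by rewrite sqrtC_ge0.
rewrite -(@ler_pXn2r _ 2)// ?nnegrE ?mulr_ge0 ?sqrtC_ge0//.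
rewrite exprMn sqrtCK mulrC; exact: norm_form_le.
Qed.

Fact vector_fun_normal x :
  vector_fun (linf_cut F x) @[F --> totally] --> (vector_fun x : C^o).
Proof.
have totF := @totally_filter I; apply/(@cvgrPdist_lt C C^o) => e e0.
exists [fset i]%fset => // F /= iF.
suff -> : vector_fun (linf_cut F x) = vector_fun x by rewrite subrr normr0.
rewrite /vector_fun /=.
by have -> : i \in F by apply: (fsubsetP iF); rewrite in_fset1.
Qed.

Definition vector_functional : l1 R d :=
  L1 vector_fun_bounded vector_fun_normal.

End VectorFunctional.

(** Uniform form of normality: off a large enough finite set of blocks, the
    functional has small norm. If [y] almost attains the norm of [f] on
    finitely many blocks, then adding to [y] a contraction supported on the
    other blocks still gives a contraction, so that [f] has almost no norm left
    there. *)
Lemma l1_tail f (e : C) : 0 < e ->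
  exists F : {fset I}, forall K x, linf_norm_le K x ->
    (forall i, i \in F -> x i = 0) -> `|f x| <= e * K.
Proof.
move=> e0; have [c c0 fc] := l1_bounded f.
have normR (z : C) : exists k : R, `|z| = k%:C%C by rewrite normc_def; eexists.
have eE : e = (complex.Re e)%:C%C by rewrite RRe_real// gtr0_real.
have cE : c = (complex.Re c)%:C%C by rewrite RRe_real// ger0_real.
move: (complex.Re e) (complex.Re c) eE cE => e' c' eE cE.
have e'0 : 0 < e' by move: e0; rewrite eE ltcR.
pose S := [set k : R | exists2 x, linf_norm_le 1 x & `|f x| = k%:C%C].
have supS : has_sup S.
  split.
    exists 0, 0; last by rewrite linear0 normr0.
    by split=> // i; apply: opnorm_le_trans (opnorm_le0 _ _ _).
  exists c' => k [x x1 fx]; have := fc _ _ x1.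
  by rewrite fx mulr1 cE lecR.
have [k [x0 x01 fx0] kS] := sup_adherent (divr_gt0 e'0 (ltr0n _ 2)) supS.
have totF := @totally_filter I.
have /(@cvgrPdist_lt C C^o)/(_ (e / 2))[] := @l1_normal R I d f x0.
  by rewrite divr_gt0.
move=> F _ /(_ F (fsubset_refl _)) /= fF; exists F.
(* A rotation makes the value at a point equal to its modulus, so that the
   suprema over moduli and over values agree. *)
have rot (z : C) : exists2 t : C, `|t| = 1 & t * z = `|z|.
  have [->|z0] := eqVneq z 0; first by exists 1; rewrite ?normr1// mulr0 normr0.
  exists (`|z| / z); last by rewrite divfK.
  by rewrite normrM normrV ?unitfE// normr_id divff// normr_eq0.
suff unit_ball x : linf_norm_le 1 x -> (forall i, i \in F -> x i = 0) ->
    `|f x| <= e.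
  move=> K x xK xF; have [K0 _] := xK.
  have [K00|Kn0] := eqVneq K 0.
    by have := fc _ _ xK; rewrite K00 !mulr0.
  have Kp : 0 < K by rewrite lt_neqAle eq_sym Kn0.
  have fK : f (K^-1 *: x) = K^-1 * f x by rewrite linearZ.
  have := unit_ball (K^-1 *: x); rewrite fK normrM.
  rewrite gtr0_norm ?invr_gt0// ler_pdivrMl// mulrC; apply.
    split=> // i; rewrite linfZE.
    have /(opnorm_leZ K^-1) : opnorm_le K (x i) by case: xK.
    by rewrite gtr0_norm ?invr_gt0// mulVf.
  by move=> i iF; rewrite linfZE xF// scaler0.
move=> x1 xF.
have [t1 t11 ft1] := rot (f (linf_cut F x0)); have [t2 t21 ft2] := rot (f x).
have [k1 fk1] := normR (f (linf_cut F x0)); have [k2 fk2] := normR (f x).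
(* The two summands live on complementary sets of blocks, hence their sum is
   again a contraction and its value is at most [sup S]. *)
have k12 : k1 + k2 <= sup S.
  apply: ub_le_sup; first by case: supS.
  exists (t1 *: linf_cut F x0 + t2 *: x).
    split=> // i; rewrite linfDE !linfZE /=; case: ifPn => iF.
      rewrite xF// scaler0 addr0 -[1]mulr1 -{1}t11.
      by apply: opnorm_leZ; case: x01.
    rewrite scaler0 add0r -[1]mulr1 -{1}t21.
    by apply: opnorm_leZ; case: x1.
  rewrite linearD !linearZ/= ft1 ft2 fk1 fk2 -rmorphD/= ger0_norm//.
  by rewrite rmorphD/= -fk1 -fk2 addr_ge0.
have kk1 : k - k1 < e' / 2.
  have := le_lt_trans (lerB_dist _ _) fF; rewrite fx0 fk1 eE.
  rewrite -(rmorphB (real_complex R))/= -[2](rmorph_nat (real_complex R)).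
  by rewrite -fmorph_div/= ltcR.
by rewrite fk2 eE lecR; lra.
Qed.

End Functionals.

Section Slicing.
Variables (R : realType) (I J : choiceType) (d : I -> nat) (e : J -> nat).
Local Notation C := R[i].
Implicit Types (X Y : linf R (tdim d e)) (f : l1 R d).

Lemma l1_sliceE f X j (r s : 'I_(e j)) :
  l1_slice f X j r s = f (linf_slicel X r s).
Proof. by rewrite mxE. Qed.

Lemma l1_sliceP f : linear (l1_slice f : linf R (tdim d e) -> linf R e).
Proof.
move=> a X Y; apply: linf_eq => j; apply/matrixP => r s.
by rewrite l1_sliceE linf_slicelP linearP !mxE.
Qed.

HB.instance Definition _ f := GRing.isLinear.Build C
  (linf R (tdim d e)) (linf R e) *:%R (l1_slice f) (l1_sliceP f).

Lemma l1_slice_tens f a (b : linf R e) : l1_slice f (linf_tens a b) = f a *: b.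
Proof.
apply: linf_eq => j; apply/matrixP => r s.
by rewrite l1_sliceE linf_slicel_tens linearZ/= mxE mulrC.
Qed.

Lemma l1_slice_mul1 f b1 b2 X :
  l1_slice f (linf_tens 1 b1 * X * linf_tens 1 b2) = b1 * l1_slice f X * b2.
Proof.
apply: linf_eq => j; apply/matrixP => r s.
rewrite l1_sliceE linf_slicel_mul1 exchange_big !linfME mxE.
rewrite linear_sum; apply: eq_bigr => u _; rewrite linear_sum mxE mulr_suml.
apply: eq_bigr => t _; rewrite linearZ/= -l1_sliceE.
by rewrite mulrAC.
Qed.

Lemma l1_slice_compress P f X :
  l1_slice (compress P f) X = l1_slice f (linf_tens P 1 * X * linf_tens P 1).
Proof.
apply: linf_eq => j; apply/matrixP => r s.
by rewrite !l1_sliceE linf_slicel_mul2.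
Qed.

(** Fubini for a normal functional [f] and a functional [n] that is only
    bounded, [y] being [(id (x) n)(X)]. On finitely many blocks this is
    linearity of [n]; the other blocks contribute little, uniformly, by
    [l1_tail]. *)
Lemma l1_fubini f (n : {scalar linf R e}) X (y : linf R d) :
  (exists2 c, 0 <= c & forall K b, linf_norm_le K b -> `|n b| <= c * K) ->
  (forall i (p q : 'I_(d i)), y i p q = n (linf_slicer X p q)) ->
  f y = n (l1_slice f X).
Proof.
move=> [c c0 nc] yE; have [Ky yK] := block_bounded y.
have [KX XK] := block_bounded X.
have [[i0]|noi] := pselect (inhabited I); last first.
  have fE x : f x = 0.
    by rewrite (_ : x = 0) ?linear0//; apply: linf_eq => i; case: noi.
  rewrite (_ : l1_slice f X = 0) ?linear0//.
  by apply: linf_eq => j; apply/matrixP => r s; rewrite l1_sliceE fE mxE.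
have Ky0 : 0 <= Ky by case: (yK i0).
have [[j0]|noj] := pselect (inhabited J); last first.
  have nE b : n b = 0.
    by rewrite (_ : b = 0) ?linear0//; apply: linf_eq => j; case: noj.
  rewrite nE (_ : y = 0) ?linear0//.
  by apply: linf_eq => i; apply/matrixP => p q; rewrite yE nE mxE.
have KX0 : 0 <= KX by case: (XK (i0, j0)).
apply/eqP; rewrite -subr_eq0; apply/eqP.
apply: (@eq0_of_small _ _ (Ky + c * KX)) => [|t t0].
  by rewrite addr_ge0// mulr_ge0.
have [F fF] := l1_tail f t0.
have fcut x : f (linf_cut F x) =
    \sum_(i <- F) \sum_p \sum_q x i p q * f (linf_unit R p q).
  rewrite linf_cut_sum linear_sum; apply: eq_bigr => i _.
  rewrite linear_sum; apply: eq_bigr => p _.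
  by rewrite linear_sum; apply: eq_bigr => q _; rewrite linearZ.
(* [Z] is the slice of [X] by the part of [f] carried by the blocks in [F]. *)
pose Z := \sum_(i <- F) \sum_(p < d i) \sum_(q < d i)
  f (linf_unit R p q) *: linf_slicer X p q.
have fy : f (linf_cut F y) = n Z.
  rewrite fcut linear_sum; apply: eq_bigr => i _.
  rewrite linear_sum; apply: eq_bigr => p _.
  rewrite linear_sum; apply: eq_bigr => q _.
  by rewrite linearZ/= yE mulrC.
have cut0 (x : linf R d) i : i \in F -> (x - linf_cut F x) i = 0.
  by move=> iF; rewrite linfDE linfNE /= iF subrr.
have cutK (x : linf R d) K : (forall i, opnorm_le K (x i)) -> 0 <= K ->
    linf_norm_le K (x - linf_cut F x).
  move=> xK K0; split=> // i; rewrite linfDE linfNE /=.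
  case: ifP => _; rewrite ?subr0 ?subrr//.
  exact: opnorm_le_trans (opnorm_le0 _ _ _).
have -> : f y - n (l1_slice f X) =
    f (y - linf_cut F y) - n (l1_slice f X - Z).
  by rewrite !linearB/= fy; ring.
apply: le_trans (ler_normB _ _) _; rewrite mulrDr; apply: lerD.
  by apply: fF; [exact: cutK | exact: cut0].
rewrite mulrCA; apply: nc.
have tK0 : 0 <= t * KX by rewrite mulr_ge0// ltW.
split=> // j; apply: opnorm_le_form => // u v.
pose S := \sum_(r < e j) \sum_(s < e j)
  ((u r 0)^* * v s 0) *: linf_slicel X r s.
have -> : \sum_r \sum_s (u r 0)^* * v s 0 * (l1_slice f X - Z) j r s =
    f (S - linf_cut F S).
  have WE r s : (l1_slice f X - Z) j r s =
      f (linf_slicel X r s - linf_cut F (linf_slicel X r s)).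
    rewrite linfDE linfNE !mxE linearB/= fcut; congr (_ - _).
    rewrite linf_sumE summxE; apply: eq_bigr => i _.
    rewrite linf_sumE summxE; apply: eq_bigr => p _.
    rewrite linf_sumE summxE; apply: eq_bigr => q _.
    by rewrite linfZE !mxE mulrC.
  have -> : S - linf_cut F S = \sum_r \sum_s ((u r 0)^* * v s 0) *:
      (linf_slicel X r s - linf_cut F (linf_slicel X r s)).
    apply: linf_eq => i; rewrite linf_sumE linfDE linfNE /=.
    under [RHS]eq_bigr do rewrite linf_sumE.
    case: ifPn => iF.
      rewrite subrr big1// => r _; rewrite big1// => s _.
      by rewrite linfZE cut0// scaler0.
    rewrite subr0 linf_sumE; apply: eq_bigr => r _; rewrite linf_sumE.
    by apply: eq_bigr => s _ /=; rewrite (negbTE iF) subr0.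
  rewrite [RHS]linear_sum; apply: eq_bigr => r _; rewrite [RHS]linear_sum.
  by apply: eq_bigr => s _; rewrite WE [RHS]linearZ.
rewrite -mulrA [KX * _]mulrC; apply: fF => [|i]; last exact: cut0.
apply: cutK => [i|]; last first.
  by rewrite mulr_ge0// sqrtC_ge0 mulr_ge0// sqnorm_ge0.
rewrite linf_sumE; under eq_bigr do rewrite linf_sumE.
by apply: opnorm_le_slice_vec; exact: (XK (i, j)).
Qed.

End Slicing.

Section FormOfSlice.
Variables (R : realType) (I J : choiceType) (d : I -> nat) (e : J -> nat).
Local Notation C := R[i].

Lemma form_l1_slice (X : linf R (tdim d e)) i j (v : 'cV[C]_(d i))
    (u : 'cV[C]_(e j)) :
  (u^t* *m l1_slice (vector_functional v v) X j *m u) 0 0 =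
  ((tens_col v u)^t* *m X (i, j) *m tens_col v u) 0 0.
Proof.
rewrite !formE big_mxtens [RHS]exchange_big; apply: eq_bigr => r _.
transitivity (\sum_s \sum_p \sum_q
  (u r 0)^* * u s 0 * ((v p 0)^* * v q 0 * mxslicel (X (i, j)) r s p q)).
  apply: eq_bigr => s _; rewrite l1_sliceE /= /vector_fun formE mulr_sumr.
  by apply: eq_bigr => p _; rewrite mulr_sumr.
rewrite exchange_big; apply: eq_bigr => p _ /=.
rewrite big_mxtens exchange_big; apply: eq_bigr => q _.
apply: eq_bigr => s _; rewrite mxslicelE !mxE !mxtens_indexK /= rmorphM/=.
by ring.
Qed.

End FormOfSlice.


(** * Positive functionals and their slice maps *)

Lemma conj_of_real (R : realType) (t t' : R[i]) :
  (forall a, a * t + a^* * t' \is Num.real) -> t' = t^*.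
Proof.
move=> real; have /CrealP := real 1; have /CrealP := real 'i.
rewrite !rmorphD !rmorphM/= !conjCK !rmorph1 conjCi !mul1r => h1 h2.
have i0 : 'i != 0 :> R[i] by exact: neq0Ci.
have h3 : t' + t'^* = t + t^*.
  apply: (mulfI i0); apply/eqP; rewrite -subr_eq0; apply/eqP.
  by move/eqP: h1; rewrite -subr_eq0 => /eqP <-; ring.
have h4 : 2 * t' = 2 * t^*.
  apply/eqP; rewrite -subr_eq0; apply/eqP.
  have -> : 2 * t' - 2 * t^* =
      (t' + t'^* - (t + t^*)) - (t^* + t'^* - (t + t')) by ring.
  by rewrite h3 h2 !subrr.
by apply: mulfI h4; rewrite pnatr_eq0.
Qed.

Section PositiveFunctionals.
Variables (R : realType) (I : Type) (d : I -> nat).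
Local Notation C := R[i].
Local Notation M := (linf R d).

(** The discriminant of the quadratic [a |-> n((x - ay)^* (x - ay))], which is
    nonnegative. That its values are real forces the form to be hermitian. *)
Lemma positive_CauchySchwarz (n : {scalar M}) :
  (forall x, 0 <= n (linf_adj x * x)) ->
  forall x y, `|n (linf_adj x * y)| ^+ 2 <=
    n (linf_adj x * x) * n (linf_adj y * y).
Proof.
move=> n0 x y; set A := n (linf_adj x * x); set B := n (linf_adj y * y).
set t := n (linf_adj x * y); set t' := n (linf_adj y * x).
have quad a : 0 <= A - a * t - a^* * t' + `|a| ^+ 2 * B.
  have := n0 (x - a *: y); congr (0 <= _).
  rewrite linf_adjB linf_adjZ mulrBl !mulrBr !linf_scalerAl !linf_scalerAr.
  rewrite scalerA !linearB/= !linearZ/= normCK -/A -/B -/t -/t'.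
  by rewrite /GRing.scale/=; ring.
have A0 : 0 <= A by exact: n0.
have B0 : 0 <= B by exact: n0.
have real a : a * t + a^* * t' \is Num.real.
  have -> : a * t + a^* * t' =
      A + `|a| ^+ 2 * B - (A - a * t - a^* * t' + `|a| ^+ 2 * B) by ring.
  apply: rpredB; last by rewrite ger0_real.
  by rewrite ger0_real// addr_ge0// mulr_ge0// exprn_ge0.
have t't : t' = t^* by exact: conj_of_real.
have [B00|Bn0] := eqVneq B 0.
  rewrite B00 mulr0; have [->|t0] := eqVneq t 0; first by rewrite normr0 expr0n.
  have T0 : 0 < `|t| ^+ 2 by rewrite exprn_gt0// normr_gt0.
  (* With this [k] the quadratic takes the value [-1] at [a = k t^*]. *)
  pose k := (A + 1) / (2 * `|t| ^+ 2).
  have k0 : 0 <= k by rewrite divr_ge0 ?mulr_ge0 ?addr_ge0// ltW.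
  have := quad (k * t^*).
  rewrite t't B00 rmorphM/= conjCK (conj_Creal (ger0_real k0)).
  have -> : A - k * t^* * t - k * t * t^* + `|k * t^*| ^+ 2 * 0 =
      A - k * (2 * `|t| ^+ 2) by rewrite mulr0 normCK; ring.
  rewrite /k divfK; last by rewrite lt0r_neq0// mulr_gt0.
  by rewrite opprD addNKr oppr_ge0 ler10.
have Bp : 0 < B by rewrite lt_neqAle eq_sym Bn0.
have := quad (t^* / B).
rewrite t't rmorphM/= conjCK fmorphV/= (conj_Creal (ger0_real B0)).
rewrite normrM normfV (ger0_norm B0) norm_conjC.
have -> : A - t^* / B * t - t / B * t^* + (`|t| / B) ^+ 2 * B =
    A - `|t| ^+ 2 / B.
  by rewrite exprMn normCK; field.
by rewrite subr_ge0 ler_pdivrMr.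
Qed.

Lemma form_scalarB (k : C) (x : M) i (v : 'cV[C]_(d i)) :
  (v^t* *m (k *: (1 : M) - x) i *m v) 0 0 =
  k * sqnorm v - (v^t* *m x i *m v) 0 0.
Proof.
rewrite linfDE linfNE linfZE linf1E mulmxBr mulmxBl -scalemxAr mulmx1.
by rewrite -scalemxAl [LHS]mxE [X in X + _]mxE [X in _ + X]mxE -sqnormE.
Qed.

Variable m : {scalar M}.
Hypothesis m_ge0 : forall x, linf_ge0 x -> 0 <= m x.

Lemma positive_norm_le x : `|m x| ^+ 2 <= m 1 * m (linf_adj x * x).
Proof.
have := positive_CauchySchwarz (fun x => m_ge0 (linf_adj_mul_ge0 x)) 1 x.
by rewrite linf_adj1 !mul1r.
Qed.

Lemma positive1_ge0 : 0 <= m 1.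
Proof. by have := m_ge0 (linf_adj_mul_ge0 1); rewrite linf_adj1 mulr1. Qed.

(** [K^2 - x^* x] is positive when [x] has norm at most [K]. *)
Lemma positive_bounded K x : linf_norm_le K x -> `|m x| <= m 1 * K.
Proof.
move=> [K0 xK]; have m10 := positive1_ge0.
rewrite -(@ler_pXn2r _ 2)// ?nnegrE ?mulr_ge0//.
apply: le_trans (positive_norm_le x) _.
rewrite exprMn expr2 -[leRHS]mulrA; apply: ler_wpM2l => //.
rewrite -subr_ge0 mulrC -linearZ/= -linearB/=; apply: m_ge0 => i v.
rewrite form_scalarB form_adj_mul subr_ge0.
by case: (xK i).
Qed.

End PositiveFunctionals.

Section PositiveSlice.
Variables (R : realType) (I J : choiceType) (d : I -> nat) (e : J -> nat).
Local Notation C := R[i].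
Variable m : {scalar linf R e}.
Hypothesis m_ge0 : forall x, linf_ge0 x -> 0 <= m x.
Implicit Types (X Y : linf R (tdim d e)).

(** For a column [v] and [z_p = sum_q v_q X_pq], Cauchy-Schwarz bounds the norm
    of the image of [v] by [m 1 * m (sum_p z_p^* z_p)], and
    [sum_p z_p^* z_p <= K^2 |v|^2] because [(z_p u)_p = X (v (x) u)]. *)
Fact positive_slice_subproof X : exists K : C, forall i : I,
  opnorm_le K (\matrix_(p < d i, q < d i) m (linf_slicer X p q)).
Proof.
have [K XK] := block_bounded X; have m10 := positive1_ge0 m_ge0.
have [[j0]|noj] := pselect (inhabited J); last first.
  exists 0 => i; rewrite (_ : \matrix_(_, _) _ = 0); first exact: opnorm_le0.
  apply/matrixP => p q; rewrite !mxE (_ : linf_slicer X p q = 0) ?linear0//.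
  by apply: linf_eq => j; case: noj.
exists (m 1 * K) => i; have K0 : 0 <= K by case: (XK (i, j0)).
split=> [|v]; first by rewrite mulr_ge0.
pose z p := \sum_q v q 0 *: linf_slicer X p q.
apply: (@le_trans _ _ (m 1 * m (\sum_p linf_adj (z p) * z p))).
  rewrite linear_sum mulr_sumr; apply: ler_sum => p _.
  rewrite (_ : (_ *m v) p 0 = m (z p)); first exact: positive_norm_le.
  rewrite mxE linear_sum; apply: eq_bigr => q _.
  by rewrite linearZ/= mxE mulrC.
rewrite exprMn expr2 -!mulrA; apply: ler_wpM2l => //.
rewrite -subr_ge0 mulrC -linearZ/= -linearB/=; apply: m_ge0 => j u.
rewrite form_scalarB subr_ge0.
rewrite linf_sumE mulmx_sumr mulmx_suml summxE.
have := (XK (i, j)).2 (tens_col v u).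
rewrite sqnorm_tens_col expr2 -!mulrA; apply: le_trans.
rewrite [leRHS]big_mxtens; apply: ler_sum => p _.
rewrite form_adj_mul /sqnorm.
apply: ler_sum => r _; rewrite le_eqVlt; apply/orP; left; apply/eqP.
congr (`|_| ^+ 2); rewrite /z linf_sumE mulmx_suml summxE mxE big_mxtens.
apply: eq_bigr => q _; rewrite linfZE -scalemxAl mxE mxE mulr_sumr.
apply: eq_bigr => s _; rewrite linf_slicerE !mxE mxtens_indexK /=.
by ring.
Qed.

(** The slice map [id (x) m]; [m] need not be normal, so that its existence
    rests on positivity. *)
Definition positive_slice X : linf R d := Linf _ (positive_slice_subproof X).

Lemma positive_sliceE X i p q : positive_slice X i p q = m (linf_slicer X p q).
Proof. by rewrite mxE. Qed.

Lemma positive_sliceP : linear positive_slice.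
Proof.
move=> a X Y; apply: linf_eq => i; apply/matrixP => p q.
by rewrite positive_sliceE linf_slicerP linearP !mxE.
Qed.

HB.instance Definition _ := GRing.isLinear.Build C
  (linf R (tdim d e)) (linf R d) *:%R positive_slice positive_sliceP.

Lemma l1_positive_slice (f : l1 R d) X :
  f (positive_slice X) = m (l1_slice f X).
Proof.
apply: l1_fubini => [|i p q]; last exact: positive_sliceE.
exists (m 1); first exact: positive1_ge0.
by move=> K b; exact: positive_bounded.
Qed.

End PositiveSlice.

(** * Gram matrices and complete positivity *)

Section GramDecomposition.
Variable R : realType.
Local Notation C := R[i].

(** Polarization: the form of [B] takes real values. *)
Lemma psd_hermitian n (B : 'M[C]_n) :
  (forall u : 'cV[C]_n, 0 <= (u^t* *m B *m u) 0 0) -> B^t* = B.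
Proof.
move=> B0; pose h (u v : 'cV[C]_n) := (u^t* *m B *m v) 0 0.
have hDr u v w a : h u (v + a *: w) = h u v + a * h u w.
  by rewrite /h mulmxDr -scalemxAr [LHS]mxE [X in _ + X]mxE.
have hDl u v w a : h (v + a *: w) u = h v u + a^* * h w u.
  rewrite /h (_ : (v + a *: w)^t* = v^t* + a^* *: w^t*); last first.
    by apply/matrixP => i j; rewrite !mxE rmorphD rmorphM.
  by rewrite !mulmxDl -!scalemxAl [LHS]mxE [X in _ + X]mxE.
have hD (u v : 'cV[C]_n) (a : C) : h (u + a *: v) (u + a *: v) =
    h u u + `|a| ^+ 2 * h v v + (a * h u v + a^* * h v u).
  rewrite hDl !hDr normCK.
  by move: (h u u) (h u v) (h v u) (h v v) => uu uv vu vv; ring.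
apply/matrixP => p q; rewrite !mxE.
have hE r s : h (delta_mx r 0) (delta_mx s 0) = B r s.
  rewrite /h (_ : (delta_mx r 0)^t* = delta_mx 0 r).
    by rewrite -rowE -colE !mxE.
  apply/matrixP => i j; rewrite !mxE andbC.
  by case: (_ && _); rewrite rmorph_nat.
apply/esym; rewrite -!hE; apply: conj_of_real => a.
have -> : a * h (delta_mx q 0) (delta_mx p 0) +
    a^* * h (delta_mx p 0) (delta_mx q 0) =
    h (delta_mx q 0 + a *: delta_mx p 0) (delta_mx q 0 + a *: delta_mx p 0) -
    (h (delta_mx q 0) (delta_mx q 0) +
     `|a| ^+ 2 * h (delta_mx p 0) (delta_mx p 0)).
  by rewrite hD addrAC subrr add0r.
by rewrite rpredB ?rpredD ?rpredM ?rpredX ?normr_real// ger0_real//; exact: B0.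
Qed.

Lemma psd_gram n (B : 'M[C]_n) :
  (forall u : 'cV[C]_n, 0 <= (u^t* *m B *m u) 0 0) ->
  exists Y : 'M[C]_n, Y^t* *m Y = B.
Proof.
move=> B0; have Bh := psd_hermitian B0.
have /orthomx_spectral_subproof[[P D] /= Pu BE] : B \is normalmx.
  by apply/normalmxP; rewrite Bh.
have D0 k : 0 <= D 0 k.
  have := B0 (P^t* *m delta_mx k 0).
  rewrite BE (invmx_unitary Pu) adjmxM adjmxK !mulmxA.
  rewrite (mulmxtVK _ Pu) -!mulmxA (mulmxA P) (unitarymxP Pu) mul1mx.
  rewrite -colE mxE (bigD1 k)//= big1 => [|l lk]; last first.
    by rewrite !mxE (negbTE lk) rmorph0 mul0r.
  by rewrite !mxE !eqxx rmorph1 mul1r addr0 mulr1n.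
exists (diag_mx (map_mx sqrtC D) *m P).
rewrite adjmxM BE (invmx_unitary Pu) !mulmxA; congr (_ *m _).
rewrite -!mulmxA; congr (_ *m _); apply/matrixP => k l.
rewrite mxE (bigD1 k)//= big1 => [|j jk]; last first.
  by rewrite !mxE (negbTE jk) mulr0n rmorph0 mul0r.
rewrite !mxE eqxx mulr1n addr0; case: eqP => _; last by rewrite !mulr0n mulr0.
rewrite !mulr1n conj_Creal ?ger0_real ?sqrtC_ge0//.
by rewrite -expr2 sqrtCK.
Qed.

Lemma eq_form n (A B : 'M[C]_n) :
  (forall v : 'cV[C]_n, (v^t* *m A *m v) 0 0 = (v^t* *m B *m v) 0 0) -> A = B.
Proof.
move=> AB; have AB0 (v : 'cV[C]_n) : (v^t* *m (A - B) *m v) 0 0 = 0.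
  by rewrite mulmxBr mulmxBl [LHS]mxE [X in _ + X]mxE AB subrr.
have [|Y YE] := @psd_gram _ (A - B); first by move=> u; rewrite AB0.
apply/eqP; rewrite -subr_eq0 -YE (_ : Y = 0) ?mulmx0//.
apply/matrixP => p q.
have /sqnorm_eq0/colP/(_ p) : sqnorm (Y *m delta_mx q 0) = 0.
  by rewrite sqnormE adjmxM mulmxA -(mulmxA (_^t*)) YE AB0.
by rewrite -colE !mxE.
Qed.

Lemma opnorm_le_sum (I : Type) (m n : I -> nat) (T : Type) (s : seq T)
    (A : T -> forall i, 'M[C]_(m i, n i)) :
  (forall t, exists K, forall i, opnorm_le K (A t i)) ->
  exists K, forall i, opnorm_le K (\sum_(t <- s) A t i).
Proof.
move=> AK; elim: s => [|t s [L IH]].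
  by exists 0 => i; rewrite big_nil; exact: opnorm_le0.
have [K tK] := AK t; exists (2 * (K + L)) => i.
by rewrite big_cons; exact: opnorm_leD.
Qed.

Variables (I : Type) (d : I -> nat).
Local Notation M := (linf R d).

(** A positive matrix over [M] is a Gram matrix. Blockwise this is the spectral
    theorem; the factors are bounded because [|Y v|^2 = <X v, v>]. *)
Lemma linf_mx_gram N (X : 'M[M]_N) : linf_mx_ge0 X ->
  exists Y : 'I_N -> 'I_N -> M,
    forall a b, X a b = \sum_c linf_adj (Y c a) * Y c b.
Proof.
move=> X0.
pose B i : 'M[C]_(N * d i) := \sum_(ab : 'I_N * 'I_N)
  delta_mx ab.1 ab.2 *t X ab.1 ab.2 i.
have BE i a b : mxslicer (B i) a b = X a b i.
  apply/matrixP => r s; rewrite mxslicerE summxE (bigD1 (a, b))//=.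
  rewrite big1 => [|[k l] kl].
    by rewrite tensmxE mxE !eqxx mul1r addr0.
  rewrite tensmxE mxE; case: eqP => [ak|]; case: eqP => [bl|]; rewrite ?mul0r//.
  by move: kl; rewrite ak bl /= eqxx.
have B0 i (u : 'cV[C]_(N * d i)) : 0 <= (u^t* *m B i *m u) 0 0.
  pose v a : 'cV[C]_(d i) := \col_r u (mxtens_index (a, r)) 0.
  have := X0 i v; congr (0 <= _).
  rewrite -mulmxA mxE big_mxtens; apply: eq_bigr => a _.
  transitivity (((v a)^t* *m \sum_b X a b i *m v b) 0 0).
    by rewrite mulmx_sumr summxE; apply: eq_bigr => b _; rewrite mulmxA.
  rewrite mxE; apply: eq_bigr => r _; rewrite !mxE; congr (_ * _).
  rewrite summxE big_mxtens; apply: eq_bigr => b _; rewrite !mxE.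
  by apply: eq_bigr => s _; rewrite -BE !mxE.
have [K BK] : exists K, forall i, opnorm_le K (B i).
  apply: opnorm_le_sum => -[a b]; have [K XK] := block_bounded (X a b).
  exists (1 * K) => i; apply: opnorm_le_tens; last exact: XK.
  exact: opnorm_le_delta.
have Y i := cid (psd_gram (B0 i)).
have YK i : opnorm_le (sqrtC K) (sval (Y i)).
  have [K0 _] := BK i; split=> [|v]; first by rewrite sqrtC_ge0.
  rewrite sqrtCK sqnormE adjmxM mulmxA -(mulmxA (v^t*)) (svalP (Y i)).
  have := norm_form_le v v (BK i); rewrite -expr2 -exprMn.
  rewrite ler_pXn2r ?nnegrE ?mulr_ge0 ?sqnorm_ge0//.
  by rewrite ger0_norm.
have Yab a b : exists K, forall i, opnorm_le K (mxslicer (sval (Y i)) a b).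
  by exists (sqrtC K) => i; apply: opnorm_le_slicer.
exists (fun a b => Linf _ (Yab a b)) => a b; apply: linf_eq => i.
rewrite linf_sumE -BE -(svalP (Y i)) mxslicerM; apply: eq_bigr => c _.
by rewrite mxslicer_adj.
Qed.

End GramDecomposition.

Section StarHomomorphisms.
Variables (R : realType) (I J : Type) (d : I -> nat) (e : J -> nat).
Local Notation C := R[i].
Variable D : {linear linf R d -> linf R e}.
Hypothesis D1 : D 1 = 1.
Hypothesis DM : forall x y, D (x * y) = D x * D y.
Hypothesis D_adj : forall x, D (linf_adj x) = linf_adj (D x).

(** A positive element is of the form [y^* y]. *)
Lemma star_hom_ge0 x : linf_ge0 x -> linf_ge0 (D x).
Proof.
move=> x0; have [|Y XY] := @linf_mx_gram _ _ _ 1 (\matrix_(a, b) x).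
  by move=> i v; rewrite !big_ord1 mxE.
have := XY 0 0; rewrite mxE big_ord1 => ->.
by rewrite DM D_adj; exact: linf_adj_mul_ge0.
Qed.

Lemma star_hom_contractive K x : linf_norm_le K x -> linf_norm_le K (D x).
Proof.
move=> [K0 xK]; split=> // j; split=> // v.
have : linf_ge0 (D (K ^+ 2 *: (1 : linf R d) - linf_adj x * x)).
  apply: star_hom_ge0 => i u; rewrite form_scalarB form_adj_mul subr_ge0.
  by case: (xK i).
move=> /(_ j v); rewrite linearB linearZ/= D1 DM D_adj.
by rewrite form_scalarB form_adj_mul subr_ge0.
Qed.

End StarHomomorphisms.

Section CompletePositivity.
Variables (R : realType) (I J K : choiceType).
Variables (d : I -> nat) (e : J -> nat) (g : K -> nat).
Local Notation C := R[i].
Variable m : {scalar linf R e}.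
Hypothesis m_ge0 : forall x, linf_ge0 x -> 0 <= m x.

Lemma form_positive_slice (U V : linf R (tdim d e)) i (u v : 'cV[C]_(d i)) :
  (u^t* *m positive_slice m_ge0 (linf_adj U * V) i *m v) 0 0 =
  \sum_t m (linf_adj (\sum_p u p 0 *: linf_slicer U t p) *
            (\sum_q v q 0 *: linf_slicer V t q)).
Proof.
rewrite mxE.
transitivity (\sum_q \sum_p \sum_t (u p 0)^* * v q 0 *
    m (linf_adj (linf_slicer U t p) * linf_slicer V t q)).
  apply: eq_bigr => q _; rewrite mxE mulr_suml; apply: eq_bigr => p _.
  rewrite positive_sliceE linf_slicerM linear_sum !mxE mulr_sumr mulr_suml.
  by apply: eq_bigr => t _; rewrite linf_slicer_adj; ring.
under eq_bigr do rewrite exchange_big.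
rewrite exchange_big; apply: eq_bigr => t _ /=.
rewrite mulr_sumr linear_sum; apply: eq_bigr => q _.
rewrite linf_adj_sum mulr_suml linear_sum; apply: eq_bigr => p _.
by rewrite linf_adjZ linf_scalerAl linf_scalerAr scalerA linearZ.
Qed.

(** [(id (x) m) o D] is completely positive: on a Gram matrix it is a sum of
    values of [m] at elements [w^* w]. *)
Lemma positive_slice_mx_ge0 (D : {linear linf R g -> linf R (tdim d e)}) :
  (forall x y, D (x * y) = D x * D y) ->
  (forall x, D (linf_adj x) = linf_adj (D x)) ->
  forall N (X : 'M[linf R g]_N), linf_mx_ge0 X ->
    linf_mx_ge0 (map_mx (fun x => positive_slice m_ge0 (D x)) X).
Proof.
move=> DM Dadj N X /linf_mx_gram[Y XY] i v.
have -> : \sum_a \sum_b ((v a)^t* *m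
    map_mx (fun x => positive_slice m_ge0 (D x)) X a b i *m v b) 0 0 =
  \sum_c \sum_a \sum_b ((v a)^t* *m
    positive_slice m_ge0 (linf_adj (D (Y c a)) * D (Y c b)) i *m v b) 0 0.
  rewrite [RHS]exchange_big; apply: eq_bigr => a _.
  rewrite [RHS]exchange_big; apply: eq_bigr => b _.
  rewrite [map_mx _ X a b]mxE XY !linear_sum linf_sumE.
  rewrite mulmx_sumr mulmx_suml summxE.
  by apply: eq_bigr => c _; rewrite DM Dadj.
apply: sumr_ge0 => c _.
under eq_bigr do under eq_bigr do rewrite form_positive_slice.
under eq_bigr do rewrite exchange_big.
rewrite exchange_big; apply: sumr_ge0 => t _.
pose w a := \sum_p v a p 0 *: linf_slicer (D (Y c a)) t p.
rewrite [X in 0 <= X](_ : _ = m (linf_adj (\sum_a w a) * \sum_a w a)).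
  exact/m_ge0/linf_adj_mul_ge0.
rewrite linf_adj_sum mulr_suml linear_sum; apply: eq_bigr => a _.
by rewrite mulr_sumr linear_sum.
Qed.

End CompletePositivity.

(** * The Galois maps and the counit *)

Section FiniteSupport.
Variable R : realType.
Local Notation C := R[i].

Section OneFamily.
Variables (I : Type) (d : I -> nat).
Implicit Types x y : linf R d.

Lemma finsuppW (J : Type) (e : J -> nat) (x : forall i, 'M[C]_(d i))
    (y : forall j, 'M[C]_(e j)) (h : I -> J) :
  (forall j, y j != 0 -> exists2 i, x i != 0 & h i = j) ->
  finitely_supported x -> finitely_supported y.
Proof.
move=> xy /(finite_image h); apply: sub_finite_set => j /= /xy[i xi <-].
by exists i.
Qed.

Lemma finsupp_linf0 : finitely_supported (0 : linf R d).
Proof.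
rewrite /finitely_supported (_ : [set i | _] = set0); first exact: finite_set0.
by apply/seteqP; split=> i //=; rewrite eqxx.
Qed.

Lemma finsuppD x y :
  finitely_supported x -> finitely_supported y -> finitely_supported (x + y).
Proof.
move=> fx fy; have : finite_set ([set i | x i != 0] `|` [set i | y i != 0]).
  by rewrite finite_setU.
apply: sub_finite_set => i xyi; have [xi|xi] := eqVneq (x i) 0; last by left.
by right; move: xyi; rewrite /mkset linfDE xi add0r.
Qed.

Lemma finsupp_sum (T : Type) (s : seq T) (F : T -> linf R d) :
  (forall t, finitely_supported (F t)) ->
  finitely_supported (\sum_(t <- s) F t).
Proof.
move=> fF; elim/big_ind: _ => //; last exact: finsuppD.
exact: finsupp_linf0.
Qed.

Lemma finsuppM x y : finitely_supported y -> finitely_supported (x * y).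
Proof.
apply: (@finsuppW _ _ _ _ id) => i xyi; exists i => //.
by apply: contraNneq xyi => yi; rewrite linfME yi mulmx0.
Qed.

Lemma finsuppZ a x : finitely_supported x -> finitely_supported (a *: x).
Proof.
apply: (@finsuppW _ _ _ _ id) => i xi; exists i => //.
by apply: contraNneq xi => xi; rewrite linfZE xi scaler0.
Qed.

End OneFamily.

Lemma finsupp_unit (I : choiceType) (d : I -> nat) i (p q : 'I_(d i)) :
  finitely_supported (linf_unit R p q).
Proof.
apply: (sub_finite_set _ (finite_set1 i)) => l; rewrite /mkset => ul.
by apply/eqP; apply: contraNT ul => li; rewrite linf_unit_neq.
Qed.

Section TwoFamilies.
Variables (I J : choiceType) (d : I -> nat) (e : J -> nat).

(** The tuple [X], read as a column vector with entries in [linf R d] and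
    placed in the column [s] of the block [j]. *)
Definition linf_column j (s : 'I_(e j)) (X : 'I_(e j) -> linf R d) :
  linf R (tdim d e) := \sum_r linf_tens (X r) (linf_unit R r s).

Lemma linf_slicel_column j (s : 'I_(e j)) (X : 'I_(e j) -> linf R d) t u :
  linf_slicel (linf_column s X) t u = if u == s then X t else 0.
Proof.
rewrite linf_slicel_sum (bigD1 t)//= big1 => [|r rt]; rewrite linf_slicel_tens.
  by rewrite linf_unitE mxE eqxx addr0; case: eqP; rewrite ?scale1r ?scale0r.
by rewrite linf_unitE mxE eq_sym (negbTE rt) scale0r.
Qed.

Lemma linf_slicel_column_neq j (s : 'I_(e j)) (X : 'I_(e j) -> linf R d) k
    (t u : 'I_(e k)) : k != j -> linf_slicel (linf_column s X) t u = 0.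
Proof.
move=> kj; rewrite linf_slicel_sum big1// => r _.
by rewrite linf_slicel_tens linf_unit_neq// mxE scale0r.
Qed.

Lemma finsupp_tens (x : linf R d) (y : linf R e) : finitely_supported x ->
  finitely_supported y -> finitely_supported (linf_tens x y).
Proof.
move=> fx fy; apply: sub_finite_set (finite_setX fx fy) => -[i j] /= xy.
by split=> /=; apply: contraNneq xy => /= ->; rewrite ?tens0mx ?tensmx0.
Qed.

Lemma finsupp_slicel (X : linf R (tdim d e)) j (r s : 'I_(e j)) :
  finitely_supported X -> finitely_supported (linf_slicel X r s).
Proof.
move=> fX; apply: (@finsuppW _ _ _ _ _ _ fst _ fX) => i Xi; exists (i, j) => //.
apply: contraNneq Xi => Xi; apply/eqP/matrixP => p q.
by rewrite linf_slicelE Xi !mxE.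
Qed.

Lemma finsupp_slicer (X : linf R (tdim d e)) i (p q : 'I_(d i)) :
  finitely_supported X -> finitely_supported (linf_slicer X p q).
Proof.
move=> fX; apply: (@finsuppW _ _ _ _ _ _ snd _ fX) => j Xj; exists (i, j) => //.
apply: contraNneq Xj => Xj; apply/eqP/matrixP => r s.
by rewrite linf_slicerE Xj !mxE.
Qed.

End TwoFamilies.
End FiniteSupport.

Section Counit.
Variables (R : realType) (G : discrete_quantum_group R).
Local Notation C := R[i].
Local Notation M := (linf R (irr_dim G)).
Implicit Types x y : M.

(** The slice map [(id (x) w_rt) o D], where [w_rt] is the entry [(r, t)] of
    the block [j]. On tuples indexed by the rows of that block, the Galois map
    [a (x) b |-> D(a)(1 (x) b)] is the matrix [(comul_l r t)_rt]. *)
Definition comul_l j (r t : 'I_(irr_dim G j)) x : M :=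
  linf_slicel (comul G x) r t.

(** The slice map [(w_pq (x) id) o D], where [w_pq] is the entry [(p, q)] of
    the block [i]. *)
Definition comul_r i (p q : 'I_(irr_dim G i)) x : M :=
  linf_slicer (comul G x) p q.

Fact comul_l_linear j (r t : 'I_(irr_dim G j)) : linear (comul_l r t).
Proof. by move=> a x y; rewrite /comul_l linearP linf_slicelP. Qed.

HB.instance Definition _ j (r t : 'I_(irr_dim G j)) :=
  GRing.isLinear.Build C M M *:%R (comul_l r t) (comul_l_linear r t).

Fact comul_r_linear i (p q : 'I_(irr_dim G i)) : linear (comul_r p q).
Proof. by move=> a x y; rewrite /comul_r linearP linf_slicerP. Qed.

HB.instance Definition _ i (p q : 'I_(irr_dim G i)) :=
  GRing.isLinear.Build C M M *:%R (comul_r p q) (comul_r_linear p q).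

(** Both sides are the value of [w_pq (x) w_rt] at [D x]. *)
Lemma comul_lrE i j (p q : 'I_(irr_dim G i)) (r t : 'I_(irr_dim G j)) x :
  comul_l r t x i p q = comul_r p q x j r t.
Proof. by rewrite mxslicelE mxslicerE. Qed.

Lemma comul_lM j (r t : 'I_(irr_dim G j)) x y :
  comul_l r t (x * y) = \sum_u comul_l r u x * comul_l u t y.
Proof. by rewrite /comul_l comulM linf_slicelM. Qed.

(** Coassociativity: both sides are the slice of [(D (x) id)(D x)] by [w_pq] on
    the left and [w_rt] on the right. *)
Lemma comul_r_l i j (p q : 'I_(irr_dim G i)) (r t : 'I_(irr_dim G j)) x :
  comul_r p q (comul_l r t x) = comul_l r t (comul_r p q x).
Proof.
apply: linf_eq => k; apply/matrixP => s u; rewrite mxslicerE mxslicelE.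
have slicelE := mxslicel_sum_delta
  (fun r t => comul G (linf_slicel (comul G x) r t) (i, k)) r t.
have slicerE := mxslicer_sum_delta
  (fun p q => comul G (linf_slicer (comul G x) p q) (k, j)) p q.
transitivity (comul_id (comul G) (comul G x) ((i, k), j)
   (mxtens_index (mxtens_index (p, s), r))
   (mxtens_index (mxtens_index (q, u), t))).
  by rewrite /comul_l -slicelE mxslicelE.
transitivity (id_comul (comul G) (comul G x) (i, (k, j))
   (mxtens_index (p, mxtens_index (s, r)))
   (mxtens_index (q, mxtens_index (u, t)))).
  rewrite comul_coassoc castmxE; congr (id_comul _ _ _ _ _); apply: val_inj;
    by rewrite /= mulnDl mulnA addnA.
by rewrite /comul_r -slicerE mxslicerE.
Qed.

Lemma mxslicel_galois_r (X : linf R (tdim (irr_dim G) (irr_dim G))) i j r s :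
  mxslicel (galois_r (comul G) X (i, j)) r s =
  \sum_t comul_l r t (linf_slicel X t s) i.
Proof.
have slice_sum := big_morph _ (@mxslicelD R _ _ r s) (@mxslicel0 R _ _ r s).
rewrite /galois_r slice_sum; apply: eq_bigr => t _ /=.
rewrite slice_sum (bigD1 s)//= big1 => [|u us].
  rewrite addr0 mxslicelM (bigD1 t)//= big1 => [|v vt].
    by rewrite addr0 mxslicel_tens mxE !eqxx scale1r mulmx1.
  by rewrite mxslicel_tens mxE (negbTE vt) scale0r mulmx0.
rewrite mxslicelM big1// => v _.
by rewrite mxslicel_tens mxE [s == u]eq_sym (negbTE us) andbF scale0r mulmx0.
Qed.

Lemma mxslicer_galois_l (X : linf R (tdim (irr_dim G) (irr_dim G))) i j p q :
  mxslicer (galois_l (comul G) X (i, j)) p q =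
  \sum_t comul_r t q (linf_slicer X p t) j.
Proof.
have slice_sum := big_morph _ (@mxslicerD R _ _ p q) (@mxslicer0 R _ _ p q).
rewrite /galois_l slice_sum (bigD1 p)//= [X in _ + X]big1 => [|u up].
  rewrite addr0 slice_sum; apply: eq_bigr => t _.
  rewrite mxslicerM (bigD1 t)//= big1 => [|v vt].
    by rewrite addr0 mxslicer_tens mxE !eqxx scale1r mul1mx.
  by rewrite mxslicer_tens mxE (negbTE vt) andbF scale0r mul0mx.
rewrite slice_sum big1// => t _.
rewrite mxslicerM big1// => v _.
by rewrite mxslicer_tens mxE eq_sym (negbTE up) scale0r mul0mx.
Qed.

Lemma finsupp_comul_l j (r t : 'I_(irr_dim G j)) x :
  finitely_supported x -> finitely_supported (comul_l r t x).
Proof.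
move=> fx; have fX := finsupp_tens fx (finsupp_unit R t t).
have [fT _ _] := galois_r_bij G.
apply: (@finsuppW _ _ _ _ _ _ _ fst _ (fT _ fX)) => i xi.
exists (i, j); last by []; apply: contraNneq xi => X0.
have := @mxslicel_galois_r (linf_tens x (linf_unit R t t)) i j r t; rewrite X0.
rewrite (bigD1 t)//= big1 => [|u ut].
  rewrite addr0 linf_slicel_tens linf_unitE mxE !eqxx scale1r => <-.
  by apply/eqP/matrixP => p q; rewrite !mxE.
rewrite linf_slicel_tens linf_unitE mxE (negbTE ut) scale0r linear0.
by apply/matrixP => p q; rewrite !mxE.
Qed.

Lemma finsupp_comul_r i (p q : 'I_(irr_dim G i)) x :
  finitely_supported x -> finitely_supported (comul_r p q x).
Proof.
move=> fx; have fX := finsupp_tens (finsupp_unit R p p) fx.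
have [fT _ _] := galois_l_bij G.
apply: (@finsuppW _ _ _ _ _ _ _ snd _ (fT _ fX)) => j xj.
exists (i, j); last by []; apply: contraNneq xj => X0.
have := @mxslicer_galois_l (linf_tens (linf_unit R p p) x) i j p q; rewrite X0.
rewrite (bigD1 p)//= big1 => [|u up].
  rewrite addr0 linf_slicer_tens linf_unitE mxE !eqxx scale1r => <-.
  by apply/eqP/matrixP => r s; rewrite !mxE.
rewrite linf_slicer_tens linf_unitE mxE (negbTE up) andbF scale0r linear0.
by apply/matrixP => r s; rewrite !mxE.
Qed.

(** Surjectivity of the first Galois map, read in one column of the block
    [j]. *)
Lemma comul_l_surj j (X : 'I_(irr_dim G j) -> M) :
  (forall r, finitely_supported (X r)) ->
  exists2 Z : 'I_(irr_dim G j) -> M, (forall t, finitely_supported (Z t)) &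
    forall r, \sum_t comul_l r t (Z t) = X r.
Proof.
move=> fX; pose s := Ordinal (irr_dim_gt0 j).
have fY : finitely_supported (linf_column s X).
  by apply: finsupp_sum => r; apply: finsupp_tens => //; exact: finsupp_unit.
have [_ _ /(_ _ fY)[Z /= fZ ZY]] := galois_r_bij G.
exists (fun t => linf_slicel Z t s) => [t|r]; first exact: finsupp_slicel.
apply: linf_eq => i; rewrite linf_sumE -mxslicel_galois_r ZY.
by rewrite -linf_slicelE linf_slicel_column eqxx.
Qed.

(** Injectivity of the first Galois map, read in one column of the block
    [j]. *)
Lemma comul_l_inj j (Z Z' : 'I_(irr_dim G j) -> M) :
  (forall t, finitely_supported (Z t)) ->
  (forall t, finitely_supported (Z' t)) ->
  (forall r, \sum_t comul_l r t (Z t) = \sum_t comul_l r t (Z' t)) ->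
  forall t, Z t = Z' t.
Proof.
move=> fZ fZ' ZZ' t; pose s := Ordinal (irr_dim_gt0 j).
have fcol (X : 'I_(irr_dim G j) -> M) : (forall t, finitely_supported (X t)) ->
    finitely_supported (linf_column s X).
  move=> fX; apply: finsupp_sum => r; apply: finsupp_tens => //.
  exact: finsupp_unit.
have [_ inj _] := galois_r_bij G.
have : linf_column s Z = linf_column s Z'.
  apply: inj; rewrite ?inE; [exact: fcol | exact: fcol |].
  apply: functional_extensionality_dep => -[i k]; apply: eq_mxslicel => r u.
  rewrite !mxslicel_galois_r; have [kj|kj] := eqVneq k j; last first.
    by apply: eq_bigr => v _; rewrite !linf_slicel_column_neq.
  rewrite kj in r u *; have := ZZ' r => /(congr1 (fun x : M => x i)).
  rewrite !linf_sumE => ZZr.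
  under eq_bigr do rewrite linf_slicel_column.
  under [RHS]eq_bigr do rewrite linf_slicel_column.
  by case: eqP => // _; apply: eq_bigr => v _; rewrite linear0.
move/(congr1 (fun X => linf_slicel X t s)).
by rewrite !linf_slicel_column eqxx.
Qed.

(** Surjectivity of the second Galois map [a (x) b |-> (a (x) 1)D(b)], at the
    element [e_oo (x) x]. *)
Lemma comul_r_surj i (o : 'I_(irr_dim G i)) x : finitely_supported x ->
  exists2 z : 'I_(irr_dim G i) -> M, (forall q, finitely_supported (z q)) &
    \sum_q comul_r q o (z q) = x.
Proof.
move=> fx; have fY := finsupp_tens (finsupp_unit R o o) fx.
have [_ _ /(_ _ fY)[Z /= fZ ZY]] := galois_l_bij G.
exists (fun q => linf_slicer Z o q) => [q|]; first exact: finsupp_slicer.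
apply: linf_eq => j; rewrite linf_sumE -mxslicer_galois_l ZY.
transitivity (linf_slicer (linf_tens (linf_unit R o o) x) o o j) => //.
by rewrite linf_slicer_tens linf_unitE mxE !eqxx scale1r.
Qed.

End Counit.

Section CounitExistence.
Variables (R : realType) (G : discrete_quantum_group R).
Local Notation C := R[i].
Local Notation M := (linf R (irr_dim G)).

(** Existence of the counit, in the form [(eps (x) id)(D(a)(1 (x) b)) = ab].
    The counit of [(w (x) id)D(z)] has to be [w(z)], which tells its value on a
    finitely supported [x] once [x] is written as [sum_q R_q(z_q)], where
    [R_q = (w_q (x) id) o D]. To check the formula for [x_r = sum_t L_rt(Z_t)],
    where [L_rt = (id (x) w_rt) o D], decompose [x_r = sum_q R_q(z_qr)] and
    solve [sum_t L_rt(Z^q_t) = z_qr]. As the [R_q] commute with the [L_rt] by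
    coassociativity and [L] is injective, [Z = sum_q R_q(Z^q)]. Finally
    [w_rt(R_q Z^q_t) = w_q(L_rt Z^q_t)], and the sum of these over [t] is
    [w_q(z_qr)]. *)
Lemma counit_exists (i0 : irr G) : exists eps : M -> C,
  forall j (Z : 'I_(irr_dim G j) -> M), (forall t, finitely_supported (Z t)) ->
  forall r, eps (\sum_t comul_l r t (Z t)) = \sum_t Z t j r t.
Proof.
pose o := Ordinal (irr_dim_gt0 i0).
have /choice[z zP] : forall x : M, exists z : 'I_(irr_dim G i0) -> M,
    finitely_supported x ->
    (forall q, finitely_supported (z q)) /\ \sum_q comul_r q o (z q) = x.
  move=> x; have [fx|nfx] := pselect (finitely_supported x).
    by have [z fz zx] := comul_r_surj o fx; exists z.
  by exists (fun=> 0).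
exists (fun x => \sum_q z x q i0 q o) => j Z fZ r.
pose X r := \sum_t comul_l r t (Z t).
have fX r' : finitely_supported (X r').
  by apply: finsupp_sum => t; exact: finsupp_comul_l.
have /choice[W WP] : forall q, exists W : 'I_(irr_dim G j) -> M,
    (forall t, finitely_supported (W t)) /\
    forall r, \sum_t comul_l r t (W t) = z (X r) q.
  move=> q; have [|W fW Wz] := @comul_l_surj _ _ j (fun r => z (X r) q).
    by move=> r'; have [] := zP _ (fX r').
  by exists W.
have ZW t : Z t = \sum_q comul_r q o (W q t).
  move: t; apply: comul_l_inj => // [t|r'].
    by apply: finsupp_sum => q; apply: finsupp_comul_r; have [] := WP q.
  under [RHS]eq_bigr do rewrite linear_sum.
  rewrite exchange_big -/(X r') -(zP _ (fX r')).2; apply: eq_bigr => q _.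
  rewrite -(WP q).2 linear_sum; apply: eq_bigr => t _.
  exact: comul_r_l.
under [RHS]eq_bigr do rewrite ZW linf_sumE summxE.
rewrite exchange_big -/(X r); apply: eq_bigr => q _.
rewrite -(WP q).2 linf_sumE summxE; apply: eq_bigr => t _.
exact: comul_lrE.
Qed.

(** Applying [eps (x) id] to [(1 (x) P)D(y)(1 (x) P) = y (x) P] compresses
    every [y] in [M_P] to a multiple of [P]. As [counit_exists] only controls
    [eps] on finitely supported elements, both sides are first multiplied by
    [c (x) 1]. *)
Lemma M_P_compression (P : M) (i0 : irr G) : exists chi : {scalar M},
  forall y, M_ P y -> P * y * P = chi y *: P.
Proof.
have [eps epsE] := counit_exists i0; pose o := Ordinal (irr_dim_gt0 i0).
have epsP (a : C) (x y : M) : finitely_supported x -> finitely_supported y ->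
    eps (a *: x + y) = a * eps x + eps y.
  move=> fx fy.
  have [|Z fZ ZE] := @comul_l_surj _ _ i0 (fun=> x); first by [].
  have [|W fW WE] := @comul_l_surj _ _ i0 (fun=> y); first by [].
  have fU t : finitely_supported (a *: Z t + W t).
    by apply: finsuppD => //; exact: finsuppZ.
  have := epsE i0 _ fU o; have := epsE i0 _ fZ o; have := epsE i0 _ fW o.
  rewrite ZE WE => -> ->.
  under eq_bigr do rewrite linearP.
  rewrite big_split -scaler_sumr ZE WE /= => ->.
  rewrite mulr_sumr -big_split; apply: eq_bigr => t _.
  by rewrite !mxE.
have [c fc c0] : exists2 c : M, finitely_supported c & eps c != 0.
  have fZ (t : 'I_(irr_dim G i0)) : finitely_supported (linf_unit R t t).
    exact: finsupp_unit.
  exists (\sum_t comul_l o t (linf_unit R t t)).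
    by apply: finsupp_sum => t; exact: finsupp_comul_l.
  rewrite (epsE i0 _ fZ) (eq_bigr (fun t => (t == o)%:R)) => [|t _]; last first.
    by rewrite linf_unitE mxE eqxx andbT eq_sym.
  rewrite (bigD1 o)//= ?eqxx big1 ?addr0 ?oner_neq0// => t /negbTE to.
  by rewrite [t == o]to.
have chi_linear : scalar (fun y : M => eps (y * c) / eps c).
  move=> a x y; rewrite mulrDl linf_scalerAl epsP; [by rewrite mulrDl mulrA| |];
  exact: finsuppM.
pose chi : {scalar M} := HB.pack (fun y : M => eps (y * c) / eps c)
  (GRing.isLinear.Build C M C *%R _ chi_linear).
exists chi => y yP; apply: linf_eq => j; apply/matrixP => r' s.
have eps0 : eps 0 = 0.
  have f0 := @finsupp_linf0 R _ (irr_dim G); have := epsP 1 0 0 f0 f0.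
  by rewrite scale1r mul1r addr0 => /eqP; rewrite -subr_eq subrr => /eqP.
have epsZ (a : C) (x : M) : finitely_supported x -> eps (a *: x) = a * eps x.
  move=> fx; have := epsP a x 0 fx (@finsupp_linf0 R _ (irr_dim G)).
  by rewrite eps0 !addr0.
have epsS (T : finType) (a : T -> C) (x : T -> M) :
    (forall t, finitely_supported (x t)) ->
    eps (\sum_t a t *: x t) = \sum_t a t * eps (x t).
  move=> fx; suff [] : finitely_supported (\sum_t a t *: x t) /\
    eps (\sum_t a t *: x t) = \sum_t a t * eps (x t) by [].
  elim/big_ind2 : _ => [|u1 u2 v1 v2 [fu1 <-] [fv1 <-]|t _].
  - by split=> //; exact: finsupp_linf0.
  - split; first exact: finsuppD.
    by have := epsP 1 u2 v2 fu1 fv1; rewrite scale1r mul1r.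
  - by split; [exact: finsuppZ | exact: epsZ].
have [|W fW WE] := @comul_l_surj _ _ j (fun r => P j r s *: c).
  by move=> r; exact: finsuppZ.
have WP r : \sum_t W t j r t = P j r s * eps c.
  by rewrite -(epsE j W fW) WE epsZ.
have fyW t : finitely_supported (y * W t) by exact: finsuppM.
(* [X] is the column [s] of [D(y)(c (x) P)] in the block [j]. *)
pose X r := \sum_u P j u s *: (comul_l r u y * c).
have fX r : finitely_supported (X r).
  by apply: finsupp_sum => u; apply: finsuppZ; exact: finsuppM.
have XE r : eps (X r) = eps c * (y * P) j r s.
  rewrite (_ : X r = \sum_t comul_l r t (y * W t)); last first.
    under [RHS]eq_bigr do rewrite comul_lM.
    rewrite exchange_big; apply: eq_bigr => u _ /=.
    by rewrite -mulr_sumr WE linf_scalerAr.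
  rewrite epsE// linfME mxE mulr_sumr.
  under eq_bigr do rewrite linfME mxE.
  rewrite exchange_big; apply: eq_bigr => u _ /=.
  by rewrite -mulr_sumr WP; ring.
have PXE : \sum_r P j r' r *: X r = P j r' s *: (y * c).
  have := congr1 (fun Z => linf_slicel Z r' s * c) yP.
  rewrite linf_slicel_mul1 linf_slicel_tens linf_scalerAl => <-.
  rewrite mulr_suml; apply: eq_bigr => t _.
  rewrite mulr_suml scaler_sumr; apply: eq_bigr => u _.
  by rewrite scalerA linf_scalerAl.
have := congr1 eps PXE; rewrite epsS// epsZ; last exact: finsuppM.
under eq_bigr do rewrite XE.
move=> PE; transitivity (eps (y * c) / eps c * P j r' s); last first.
  by rewrite linfZE mxE.
rewrite mulrAC [X in X / _]mulrC -PE -mulrA linfME mxE mulr_suml.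
apply: eq_bigr => u _; rewrite [X in X / _]mulrCA [X in X / _]mulrC.
by rewrite mulfK.
Qed.

End CounitExistence.

(** * From a projection onto [M_P] to an invariant state *)

Section Forward.
Variables (R : realType) (G : discrete_quantum_group R).
Local Notation C := R[i].
Local Notation M := (linf R (irr_dim G)).
Variable P : M.
Hypotheses (P_neq0 : P <> 0) (P_glp : group_like_projection P).

Lemma linf_neq0 (x : M) : x <> 0 -> exists i, x i != 0.
Proof.
move=> x0; apply: contrapT => nx; apply: x0; apply: linf_eq => i.
by apply/eqP/negPn/negP => xi; apply: nx; exists i.
Qed.

Lemma projection_form i (v : 'cV[C]_(irr_dim G i)) :
  (v^t* *m P i *m v) 0 0 = sqnorm (P i *m v).
Proof. by have [Padj PP _] := P_glp; rewrite -{1}PP -{1}Padj form_adj_mul. Qed.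

Lemma projection_scale_inj (a b : C) : a *: P = b *: P -> a = b.
Proof.
move=> ab; have [i Pi] := linf_neq0 P_neq0; apply/eqP; rewrite -subr_eq0.
have : (a - b) *: P i = 0.
  have := congr1 (fun x : M => x i) ab; rewrite !linfZE scalerBl => ->.
  by rewrite subrr.
by move/eqP; rewrite scaler_eq0 (negbTE Pi) orbF.
Qed.

(** A nonzero column [P e_q] has positive norm, and its form is [a] times
    that. *)
Lemma projection_scale_ge0 (a : C) : linf_ge0 (a *: P) -> 0 <= a.
Proof.
move=> aP; have [k] := linf_neq0 P_neq0; apply: contraNT => a0.
apply/eqP/matrixP => p q; rewrite [RHS]mxE.
have := aP k (delta_mx q 0).
rewrite linfZE -scalemxAr -scalemxAl mxE projection_form => aq.
have q0 := sqnorm_ge0 (P k *m delta_mx q 0).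
have /sqnorm_eq0/colP/(_ p) : sqnorm (P k *m delta_mx q 0) = 0.
  apply/eqP; rewrite eq_le q0 andbT; apply: contraNT a0.
  rewrite -real_ltNge ?ger0_real// => q1.
  by rewrite -(pmulr_lge0 _ q1).
by rewrite -colE !mxE.
Qed.

Lemma group_like_M_P : M_ P P.
Proof.
have [_ PP PD] := P_glp.
by rewrite /M_ /= PD linf_tensM mulr1 PP.
Qed.

(** The state is [chi o E], where [P E(x) P = chi(E x) P]; it is the counit
    composed with [E]. Its invariance is the module property of [E] compressed
    by [P], and it takes the value [1] at [P] because [P] itself belongs to
    [M_P]. *)
Lemma invariant_state_of_amenable : amenable (M_ P) ->
  exists m : {scalar M},
    [/\ state m, m P <> 0 &
        forall f x, lact (compress P f) m x = f P * m x].
Proof.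
have [Padj PP _] := P_glp; have [i0 _] := linf_neq0 P_neq0.
move=> [E [E1 Ecp Emod EE Erange]].
have [chi chiP] := M_P_compression P i0.
have EM x : M_ P (E x) by rewrite -Erange; exists x.
have mP x : P * E x * P = chi (E x) *: P by exact/chiP/EM.
have m_linear : scalar (fun x => chi (E x)) by move=> a x y; rewrite !linearP.
pose m : {scalar M} := HB.pack (fun x : M => chi (E x))
  (GRing.isLinear.Build C M C *%R _ m_linear).
have EP : E P = P.
  have [x _ <-] : range E P by rewrite Erange; exact: group_like_M_P.
  exact: EE.
exists m; split; first split.
- apply: projection_scale_inj; rewrite -[m 1 *: P]mP E1 mulr1 PP.
  by rewrite scale1r.
- move=> x x0; apply: projection_scale_ge0; rewrite -[m x *: P]mP.
  rewrite -{1}Padj; apply: linf_ge0_conj.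
  have x0' : linf_mx_ge0 (\matrix_(a < 1, b < 1) x).
    by move=> i v; rewrite !big_ord1 mxE.
  by move=> i v; have := Ecp _ _ x0' i (fun=> v); rewrite !big_ord1 !mxE.
- have -> : m P = 1.
    apply: projection_scale_inj; rewrite -[m P *: P]mP EP PP PP.
    by rewrite scale1r.
  exact/eqP/oner_neq0.
- move=> f x; apply: projection_scale_inj.
  rewrite /lact -[m _ *: P]mP Emod /ract.
  rewrite -l1_slice_mul1 (EM x) l1_slice_tens; congr (_ *: P).
  by rewrite /= /compress_fun mP linearZ/= mulrC.
Qed.

End Forward.

(** * From an invariant state to a projection onto [M_P] *)

Section Backward.
Variables (R : realType) (G : discrete_quantum_group R).
Local Notation C := R[i].
Local Notation M := (linf R (irr_dim G)).
Variable P : M.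
Hypothesis P_glp : group_like_projection P.
Variable m : {scalar M}.
Hypotheses (m_state : state m) (mP_neq0 : m P <> 0).
Hypothesis m_inv : forall f x, lact (compress P f) m x = f P * m x.

Local Notation h1 := (linf_tens P (1 : M)).
Local Notation h2 := (linf_tens (1 : M) P).

Let P_adj : linf_adj P = P. Proof. by case: P_glp. Qed.
Let PP : P * P = P. Proof. by case: P_glp. Qed.
Let h2D : h2 * comul G P = h1 * h2.
Proof. by case: P_glp => _ _ ->; rewrite linf_tensM mul1r mulr1. Qed.
Let h2h1 : h2 * h1 = h1 * h2. Proof. by rewrite !linf_tensM !mul1r !mulr1. Qed.
Let h1h1 : h1 * h1 = h1. Proof. by rewrite linf_tensM PP mulr1. Qed.
Let h2h2 : h2 * h2 = h2. Proof. by rewrite linf_tensM PP mulr1. Qed.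
Let h1_adj : linf_adj h1 = h1.
Proof. by rewrite linf_adj_tens P_adj linf_adj1. Qed.
Let h2_adj : linf_adj h2 = h2.
Proof. by rewrite linf_adj_tens P_adj linf_adj1. Qed.
Let D_adj : linf_adj (comul G P) = comul G P.
Proof. by rewrite -comul_adj P_adj. Qed.
Let DD : comul G P * comul G P = comul G P. Proof. by rewrite -comulM PP. Qed.
Let Dh2 : comul G P * h2 = h1 * h2.
Proof.
by rewrite -{1}D_adj -{1}h2_adj -linf_adjM h2D linf_adjM h1_adj h2_adj.
Qed.

(** The invariance of [m] passes to [m(P . P)]. It would follow from
    [D(P)(P (x) 1) = P (x) P], the analogue of the existence of inverses in a
    subgroup; the following takes the place of that identity. Let
    [Phi X = m((f (x) id)(X))] and [W = (P (x) 1)D(P)(P (x) 1)]. The group-like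
    property gives [W - P (x) P = V^* V], with [V = D(P)(P (x) (1 - P))], while
    the invariance of [m] at [P] gives [Phi(W) = f(P)m(P) = Phi(P (x) P)].
    Hence [Phi(V^* V) = 0], and by Cauchy-Schwarz [Phi] vanishes on everything
    that has [V] as a right factor or [V^*] as a left factor. So [Phi] takes
    the same value at [(P (x) 1)D(PxP)(P (x) 1)] and at its compression by
    [1 (x) P]. *)
Lemma invariant_compress i (v : 'cV[C]_(irr_dim G i)) x :
  m (P * ract x (compress P (vector_functional v v)) * P) =
  vector_functional v v P * m (P * x * P).
Proof.
set f := vector_functional v v.
pose Phi_fun X := m (l1_slice f X).
have Phi_linear : scalar Phi_fun by move=> a X Y; rewrite /Phi_fun !linearP.
pose Phi : {scalar linf R (tdim (irr_dim G) (irr_dim G))} :=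
  HB.pack Phi_fun (GRing.isLinear.Build C _ C *%R _ Phi_linear).
have Phi_ge0 X : 0 <= Phi (linf_adj X * X).
  apply: m_state.2 => j u; rewrite form_l1_slice.
  exact: (@linf_adj_mul_ge0 _ _ _ X (i, j) (tens_col v u)).
pose D := comul G P; pose Z := comul G x; pose W := h1 * D * h1.
pose V := D * h1 * (1 - h2).
have Dh1h2 : D * (h1 * h2) = h1 * h2.
  by rewrite -h2h1 mulrA Dh2 -mulrA h2h1 mulrA h1h1.
have h1h2D : h1 * h2 * D = h1 * h2 by rewrite -mulrA h2D mulrA h1h1.
have Wh2 : W * h2 = h1 * h2 by rewrite /W -!mulrA Dh1h2 mulrA h1h1.
have h2W : h2 * W = h1 * h2.
  by rewrite /W !mulrA h2h1 h1h2D -mulrA h2h1 mulrA h1h1.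
have V_adj : linf_adj V = (1 - h2) * h1 * D.
  by rewrite /V !linf_adjM linf_adjB linf_adj1 h1_adj h2_adj D_adj mulrA.
have VV : linf_adj V * V = W - h1 * h2.
  rewrite V_adj (_ : _ * V = (1 - h2) * W * (1 - h2)).
    rewrite mulrBl mul1r h2W mulrBr mulr1 mulrBl Wh2 -mulrA h2h2.
    by rewrite subrr subr0.
  by rewrite /V /W !mulrA -[_ * D * D]mulrA DD.
have PhiV0 : Phi (linf_adj V * V) = 0.
  rewrite VV linearB /= /Phi_fun -l1_slice_compress linf_tensM mulr1 mul1r.
  rewrite l1_slice_tens linearZ/= -/(ract P _).
  by have := m_inv f P; rewrite /lact => ->; rewrite subrr.
have PhiUV U : Phi (linf_adj U * V) = 0.
  have := positive_CauchySchwarz Phi_ge0 U V; rewrite PhiV0 mulr0 => UV.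
  by apply/eqP; rewrite -normr_eq0 -sqrf_eq0 eq_le UV exprn_ge0.
have PhiVU U : Phi (linf_adj V * U) = 0.
  have := positive_CauchySchwarz Phi_ge0 V U; rewrite PhiV0 mul0r => VU.
  by apply/eqP; rewrite -normr_eq0 -sqrf_eq0 eq_le VU exprn_ge0.
pose A := h1 * (D * Z * D) * h1.
have PhiA : Phi A = f P * m (P * x * P).
  rewrite /= /Phi_fun -l1_slice_compress -!comulM -/(ract _ _).
  exact: m_inv.
have h2Ah2 : h2 * A * h2 = h2 * (h1 * Z * h1) * h2.
  transitivity (h2 * h1 * D * Z * (D * (h1 * h2))); first by rewrite /A !mulrA.
  by rewrite Dh1h2 h2h1 h1h2D !mulrA h2h1.
have PhiB : Phi (h2 * A * h2) = m (P * ract x (compress P f) * P).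
  by rewrite h2Ah2 /= /Phi_fun l1_slice_mul1 -l1_slice_compress.
rewrite -PhiA -PhiB; apply/eqP; rewrite eq_sym -subr_eq0 -linearB.
have -> : A - h2 * A * h2 =
    linf_adj (linf_adj (h1 * D * Z)) * V + linf_adj V * (Z * D * h1 * h2).
  rewrite linf_adjK V_adj.
  transitivity (A * (1 - h2) + (1 - h2) * A * h2); last first.
    by rewrite /A /V !mulrA.
  by rewrite mulrBr mulr1 mulrBl mul1r mulrBl addrA subrK.
by rewrite linearD PhiUV PhiVU addr0.
Qed.

End Backward.

Section Expectation.
Variables (R : realType) (G : discrete_quantum_group R).
Local Notation C := R[i].
Local Notation M := (linf R (irr_dim G)).
Variable P : M.
Hypothesis P_glp : group_like_projection P.
Variable m : {scalar M}.
Hypotheses (m_state : state m) (mP_neq0 : m P <> 0).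
Hypothesis m_inv : forall f x, lact (compress P f) m x = f P * m x.

(** On [M_P] this functional is the counit, since [PyP] is then the multiple of
    [P] by the counit of [y]; the state [m], which only has to charge [P], need
    not be. *)
Definition normalized_compression (x : M) : C := m (P * x * P) / m P.

Fact normalized_compression_linear : scalar normalized_compression.
Proof.
move=> a x y; rewrite /normalized_compression mulrDr mulrDl.
by rewrite linf_scalerAr linf_scalerAl linearP mulrDl mulrA.
Qed.

HB.instance Definition _ := GRing.isLinear.Build C M C *%R
  normalized_compression normalized_compression_linear.

Let P_adj : linf_adj P = P. Proof. by case: P_glp. Qed.
Let PP : P * P = P. Proof. by case: P_glp. Qed.

Fact normalized_compression_ge0 x :
  linf_ge0 x -> 0 <= normalized_compression x.
Proof.
move=> x0; rewrite /normalized_compression divr_ge0//.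
  by apply: m_state.2; rewrite -{1}P_adj; exact: linf_ge0_conj.
by apply: m_state.2; rewrite -PP -{1}P_adj; exact: linf_adj_mul_ge0.
Qed.

Local Notation m' := normalized_compression.

(** In a group, averaging a function over the cosets of the subgroup by means
    of [m']. *)
Definition expectation (x : M) : M :=
  positive_slice normalized_compression_ge0 (comul G x).

Fact expectation_linear : linear expectation.
Proof. by move=> a x y; rewrite /expectation !linearP. Qed.

HB.instance Definition _ := GRing.isLinear.Build C M M *:%R
  expectation expectation_linear.

Lemma expectationE x i (p q : 'I_(irr_dim G i)) :
  expectation x i p q = m' (comul_r p q x).
Proof. exact: positive_sliceE. Qed.

Lemma l1_expectation (f : l1 R (irr_dim G)) x :
  f (expectation x) = m' (ract x f).
Proof. exact: l1_positive_slice. Qed.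

Lemma expectation1 : expectation 1 = 1.
Proof.
apply: linf_eq => i; apply/matrixP => p q; rewrite expectationE.
rewrite /comul_r comul1 -linf_tens11 linf_slicer_tens linearZ/=.
rewrite /m' mulr1 PP divff ?mulr1//; exact/eqP.
Qed.

(** Tested on vector functionals, this is the invariance of [m']. *)
Lemma expectation_compress x : P * expectation x * P = m' x *: P.
Proof.
apply: linf_eq => j; apply: eq_form => v.
pose f := vector_functional v v.
rewrite -[LHS]/(compress P f (expectation x)).
rewrite l1_expectation /m' invariant_compress//.
by rewrite linfZE -scalemxAr -scalemxAl [RHS]mxE -mulrA mulrC.
Qed.

(** Applying [D] to a slice by [m'] is slicing [(D (x) id) o D]: the entries of
    [D] are normal functionals, and these commute with [m'] by [l1_fubini]. *)
Lemma comul_r_expectation i (p q : 'I_(irr_dim G i)) x :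
  comul_r p q (expectation x) = expectation (comul_r p q x).
Proof.
apply: linf_eq => j; apply/matrixP => r s.
have [f fE] := comul_normal
  (@vector_functional R _ (tdim (irr_dim G) (irr_dim G)) (i, j)
    (delta_mx (mxtens_index (p, r)) 0) (delta_mx (mxtens_index (q, s)) 0)).
have {}fE y : f y = comul_r p q y j r s.
  rewrite fE /= /vector_fun.
  rewrite (_ : (delta_mx _ 0)^t* = delta_mx 0 (mxtens_index (p, r))).
    by rewrite -rowE -colE !mxE.
  apply/matrixP => a b; rewrite !mxE andbC.
  by case: (_ && _); rewrite rmorph_nat.
rewrite -fE l1_expectation expectationE; congr (m' _).
apply: linf_eq => k; apply/matrixP => t u.
by rewrite l1_sliceE fE -/(comul_l t u x) comul_r_l comul_lrE.
Qed.

(** Fubini for [f] and for the functional [z |-> m'((w_rs (x) id)D(z))], which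
    is bounded because [D] is contractive. *)
Lemma expectation_ract x (f : l1 R (irr_dim G)) :
  expectation (ract x f) = ract (expectation x) f.
Proof.
apply: linf_eq => j; apply/matrixP => r s.
rewrite expectationE [RHS]l1_sliceE -/(comul_l r s (expectation x)).
have n_linear : scalar (fun z => m' (comul_r r s z)).
  by move=> a y z; rewrite !linearP.
pose n : {scalar M} := HB.pack (fun z : M => m' (comul_r r s z))
  (GRing.isLinear.Build C M C *%R _ n_linear).
apply/esym; apply: (@l1_fubini _ _ _ _ _ f n (comul G x)) => [|i p q].
  exists (m' 1); first exact: positive1_ge0 normalized_compression_ge0.
  move=> K b bK; apply: positive_bounded.
    exact: normalized_compression_ge0.
  have [K0 DbK] :=
    star_hom_contractive (comul1 G) (@comulM _ G) (@comul_adj _ G) bK.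
  by split=> // k; apply: opnorm_le_slicer; exact: (DbK (j, k)).
by rewrite comul_lrE comul_r_expectation expectationE.
Qed.

(** Slicing [(1 (x) P)D(E x)(1 (x) P)] by [w_pq] gives
    [P E(x_pq) P = m'(x_pq) P], for [x_pq = (w_pq (x) id)D(x)], and [m'(x_pq)]
    is the entry [(p, q)] of [E x]. *)
Lemma expectation_M_P x : M_ P (expectation x).
Proof.
apply: eq_linf_slicer => i p q.
rewrite linf_slicer_mul1 -/(comul_r p q _) comul_r_expectation.
by rewrite expectation_compress linf_slicer_tens expectationE.
Qed.

Lemma expectation_id y : M_ P y -> expectation y = y.
Proof.
move=> yP; apply: linf_eq => i; apply/matrixP => p q; rewrite expectationE.
rewrite /m' /comul_r -linf_slicer_mul1 yP linf_slicer_tens linearZ/=.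
by rewrite mulfK//; exact/eqP.
Qed.

Lemma amenable_of_invariant_state : amenable (M_ P).
Proof.
exists expectation; split.
- exact: expectation1.
- move=> N X; apply: positive_slice_mx_ge0; [exact: comulM | exact: comul_adj].
- exact: expectation_ract.
- by move=> x; apply/expectation_id/expectation_M_P.
- apply/seteqP; split=> [_ [x _ <-]|x xP]; first exact: expectation_M_P.
  by exists x => //; exact: expectation_id.
Qed.

End Expectation.

Theorem theorem3p9 (R : realType) (G : discrete_quantum_group R)
    (P : linf R (irr_dim G)) :
  P <> 0 -> group_like_projection P ->
  (amenable (M_ P) <->
  exists m : {scalar linf R (irr_dim G)},
    [/\ state m, m P <> 0 &
        forall (f : l1 R (irr_dim G)) (x : linf R (irr_dim G)),
          lact (compress P f) m x = f P * m x]).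
Proof.
move=> P0 Pglp; split; first exact: invariant_state_of_amenable.
by move=> [m [m_state mP m_inv]]; exact: amenable_of_invariant_state m_inv.
Qed.
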